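(* Fix $\eta>0$, and let $\chi$ be the cut-off operator defined in the context. There exist constants $C_0,C_1,C_L>0$ such that: (i) $\chi$ is well defined as a map from $H^1_{-\eta}(\mathbb{R},\mathbb{R}^n)$ into $H^1_{-\eta}(\mathbb{R},\mathbb{R}^n)$; (ii) $\chi\circ\tau_y=\tau_y\circ\chi$ for all $y\in\mathbb{R}$, where $(\tau_y u)(x)=u(x-y)$; (iii) $\chi(u)=u$ whenever $u\in H^1_{\mathrm{u}}(\mathbb{R},\mathbb{R}^n)$ and $\|u\|_{H^1_{\mathrm{u}}}<C_0$; (iv) for all $u\in H^1_{-\eta}(\mathbb{R},\mathbb{R}^n)$, $\chi(u)\in H^1_{\mathrm{u}}(\mathbb{R},\mathbb{R}^n)$ and $\|\chi(u)\|_{H^1_{\mathrm{u}}}<C_1$; (v) $\chi:H^1_{-\eta}(\mathbb{R},\mathbb{R}^n)\to H^1_{-\eta}(\mathbb{R},\mathbb{R}^n)$ is globally Lipschitz continuous with Lipschitz constant $C_L$.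
   Context: Let $n\ge 1$. Function spaces. For $\eta>0$, $H^1_{-\eta}(\mathbb{R},\mathbb{R}^n)$ is the exponentially weighted Sobolev space of functions $u\in H^1_{\mathrm{loc}}(\mathbb{R},\mathbb{R}^n)$ with finite norm $\|u\|_{H^1_{-\eta}}^2=\int_{\mathbb{R}} e^{-2\eta|x|}\left(|u(x)|^2+|u'(x)|^2\right)dx$ (equivalently, up to constants, $\sum_{j\in\mathbb{Z}}e^{-2\eta|j|}\|u\|^2_{H^1([j,j+1],\mathbb{R}^n)}$); exponential growth at $\pm\infty$ is allowed. $H^1_{\mathrm{u}}(\mathbb{R},\mathbb{R}^n)$ is the space of functions $u\in H^1_{\mathrm{loc}}(\mathbb{R},\mathbb{R}^n)$ with finite norm $\|u\|_{H^1_{\mathrm{u}}}=\sup_{y\in\mathbb{R}}\|u(\cdot-y)\|_{H^1([0,1],\mathbb{R}^n)}$. One has $H^1_{\mathrm{u}}\subset H^1_{-\eta}$ for every $\eta>0$. Auxiliary functions (fixed once and for all). $\underline{\chi}:\mathbb{R}\to\mathbb{R}$ is a smooth version of the characteristic function of $[-1,1]$, that is, $\underline{\chi}(x)=0$ for $|x|>2$, $\underline{\chi}(x)=1$ for $|x|<1$, and $0\le|\underline{\chi}'(x)|\le 2$. $\theta:\mathbb{R}\to\mathbb{R}$ is a smooth generator of a $\mathbb{Z}$-invariant partition of unity: $\sum_{j\in\mathbb{Z}}\theta(x-j)=1$ for all $x$, $\mathrm{supp}\,\theta\subset(-\tfrac14,\tfrac54)$, $\theta\ge 0$, and $\theta([0,1])\subset[\tfrac12,1]$.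 Cut-off operator. For $u\in H^1_{-\eta}(\mathbb{R},\mathbb{R}^n)$, $$[\chi(u)](x)=\int_{y\in\mathbb{R}}\underline{\chi}\left(\|\theta(\cdot-y)u(\cdot)\|_{H^1(\mathbb{R},\mathbb{R}^n)}\right)\theta(x-y)\,u(x)\,dy.$$ *)

(* Defs.v *)
From HB Require Import structures.
From mathcomp Require Import all_boot all_order all_algebra.
From mathcomp Require Import all_classical all_reals all_analysis.

Set Implicit Arguments.
Unset Strict Implicit.
Unset Printing Implicit Defensive.

Import Order.TTheory GRing.Theory Num.Theory.
Import numFieldNormedType.Exports.

Local Open Scope classical_set_scope.
Local Open Scope ring_scope.

Section Sobolev.
Context {R : realType}.

Notation leb := (@lebesgue_measure R).

Definition smooth (f : R -> R) : Prop :=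
  forall (k : nat) (x : R), derivable (derive1n k f) x 1.

(* Closed support. *)
Definition supp (f : R -> R) : set R := closure [set x | f x != 0].

(* C_c^oo(R) *)
Definition test_function (phi : R -> R) : Prop :=
  smooth phi /\ compact (supp phi).

Section Vector.
Context {n : nat}.
Implicit Types u v : R -> 'rV[R]_n.

(* Squared Euclidean norm; the library norm on 'rV_n is the max norm. *)
Definition sqnorm (a : 'rV[R]_n) : R := \sum_(i < n) a 0 i ^+ 2.

Definition L1loc u : Prop :=
  forall i, locally_integrable setT (fun x => u x 0 i).

Definition L2loc u : Prop :=
  (forall i, measurable_fun setT (fun x => u x 0 i)) /\
  (forall K : set R, compact K ->
    (\int[leb]_(x in K) (sqnorm (u x))%:E < +oo)%E).

Definition is_weak_derivative u v : Prop :=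
  [/\ L1loc u, L1loc v &
    forall phi i, test_function phi ->
      \int[leb]_x (u x 0 i * derive1 phi x) = - \int[leb]_x (v x 0 i * phi x)].

(* A chosen representative of the weak derivative, which is unique up to a null
   set; the zero function when u has no weak derivative. *)
Definition weakD u : R -> 'rV[R]_n := xget (fun=> 0) [set v | is_weak_derivative u v].

Definition H1loc u : Prop :=
  L2loc u /\ exists v, is_weak_derivative u v /\ L2loc v.

(* ( \int_D w (|u|^2 + |u'|^2) )^(1/2), with values in [0, +oo]; meaningful for
   u in H^1_loc. *)
Definition weighted_H1_norm (w : R -> R) (D : set R) u : \bar R :=
  ((\int[leb]_(x in D) (w x * (sqnorm (u x) + sqnorm (weakD u x)))%:E) `^ 2^-1)%E.

Definition H1_norm_on (D : set R) u : \bar R := weighted_H1_norm (fun=> 1) D u.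

Definition H1_norm u : \bar R := H1_norm_on setT u.

Definition H1 u : Prop := H1loc u /\ (H1_norm u < +oo)%E.

(* H^1_{-eta} *)
Definition H1exp_norm (eta : R) u : \bar R :=
  weighted_H1_norm (fun x => expR (- (2 * eta * `|x|))) setT u.

Definition H1exp (eta : R) u : Prop :=
  H1loc u /\ (H1exp_norm eta u < +oo)%E.

Definition translate (y : R) u : R -> 'rV[R]_n := fun x => u (x - y).

(* H^1_u, the uniformly local space *)
Definition H1u_norm u : \bar R :=
  ereal_sup (range (fun y : R => H1_norm_on `[0, 1] (translate y u))).

Definition H1u u : Prop := H1loc u /\ (H1u_norm u < +oo)%E.

(* theta(. - y) u(.) *)
Definition localize (theta : R -> R) (y : R) u : R -> 'rV[R]_n :=
  fun x => theta (x - y) *: u x.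

(* The i-th component of the integrand, as a function of y, in the integral
   over y that defines [chi(u)](x). *)
Definition cutoff_integrand (chib theta : R -> R) u (x : R) (i : 'I_n) (y : R) : R :=
  chib (fine (H1_norm (localize theta y u))) * theta (x - y) * u x 0 i.

Definition cutoff (chib theta : R -> R) u : R -> 'rV[R]_n :=
  fun x => \row_(i < n) \int[leb]_y cutoff_integrand chib theta u x i y.

End Vector.

Definition is_cutoff_function (chib : R -> R) : Prop :=
  [/\ smooth chib,
      forall x, 2 < `|x| -> chib x = 0,
      forall x, `|x| < 1 -> chib x = 1 &
      forall x, 0 <= `|derive1 chib x| <= 2].

(* By the support condition, the sum over all integers has finite support for
   every x, so that it is a genuine sum and not the default value 0. *)
Definition is_partition_generator (theta : R -> R) : Prop :=
  [/\ smooth theta,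
      forall x : R, \sum_(j \in [set: int]) theta (x - j%:~R) = 1,
      supp theta `<=` `](- (1 / 4)), (5 / 4)[,
      forall x, 0 <= theta x &
      theta @` `[0, 1] `<=` `[(1 / 2), 1]].

End Sobolev.

(* Main.v *)
(* Put h(y) = chib(|theta(. - y) u|_{H^1}). Then chi(u) = g u, where g is the
   convolution of the bounded measurable weight h with theta, hence smooth; the
   product rule gives chi(u) in H^1_loc and, jointly with its weak derivative,
   chi(u) = \int h(y) U_y dy with U_y the pair of theta(. - y) u and its weak
   derivative. Since U_y lives on |x - y| <= 2, Cauchy-Schwarz in y and Tonelli
   bound a weighted H^1 norm of chi(u) - chi(v) by the integral over y of the
   squared norms of F(U_y) - F(V_y), with F(U) = chib(|U|) U. The map F is
   bounded, which gives the uniform bound, and globally Lipschitz, which gives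
   the Lipschitz estimate after a second use of Tonelli. Small u have h = 1, and
   the translates of theta have integral 1, so chi(u) = u.
   The chosen representative of the weak derivative is controlled by uniqueness:
   Lebesgue differentiation, with rescalings of theta itself as mollifiers. *)
Require Import Defs.
From mathcomp Require Import all_boot all_order all_algebra.
From mathcomp Require Import all_classical all_reals all_analysis.
From mathcomp Require Import measurable_realfun ring lra zify.
Import Order.TTheory GRing.Theory Num.Theory.
Import numFieldNormedType.Exports.
Set Implicit Arguments.
Unset Strict Implicit.
Unset Printing Implicit Defensive.
Local Open Scope classical_set_scope.
Local Open Scope ring_scope.

(** * Smooth functions *)

(** The norms of the statement involve [weakD], a choice that commutes with no operation. Every
    computation therefore carries an explicit derivative in an [H1pair], and [weakD] is met only
    where a norm is opened. The weight [h] depends on [u] through norms, so little regularity in [y]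
    is available. All derivatives are made to fall on [theta], and [h] enters as a bounded
    measurable factor. The nonlinearity then acts separately for each [y], on a single vector in a
    Hilbert space, and the Lipschitz constant of the truncation does not depend on the size of [u],
    which may grow exponentially. Estimates are kept for squared norms with values in [[0, +oo]],
    where Tonelli applies without integrability conditions. The triangle inequality is recovered
    from a one-parameter family of quadratic inequalities. Constants: the support of [theta] is
    rounded to radius 2, so the relevant [y] fill an interval of length 4; [M] bounds [theta] and
    its derivative; [chib] is bounded by 6; a shift by 2 changes the exponential weight by at most
    the factor [expR (4 * eta)]. *)

Section SmoothCalculus.
Context {R : realType}.
Implicit Types f g : R -> R.

Lemma smoothP f :
  smooth f <-> (forall x, derivable f x 1) /\ smooth (derive1 f).
Proof.
split=> [sf|[df sf]].
  split=> [x|k x]; first exact: (sf 0%N x).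
  by rewrite -derive1Sn; exact: sf.
by case=> [|k] x //; rewrite derive1Sn; exact: sf.
Qed.

Lemma smooth_derivable f x : smooth f -> derivable f x 1.
Proof. by move=> /smoothP[]. Qed.

Lemma smooth_derive1 f : smooth f -> smooth (derive1 f).
Proof. by move=> /smoothP[]. Qed.

Lemma smooth_continuous f : smooth f -> continuous f.
Proof.
move=> sf x; apply: differentiable_continuous.
exact/derivable1_diffP/smooth_derivable.
Qed.

(* The order bound [N] makes the induction go through: the derivative of a
   product is a sum of products of functions of one order less. *)
Let derivable_upto N f :=
  forall k (x : R), (k <= N)%N -> derivable (derive1n k f) x 1.

Let derivable_uptoS N f : derivable_upto N.+1 f ->
  (forall x : R, derivable f x 1) /\ derivable_upto N (derive1 f).
Proof.
move=> df; split=> [x|k x kN]; first exact: (df 0%N).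
by rewrite -derive1Sn; exact: df.
Qed.

Let derivable_upto_intro N f : (forall x : R, derivable f x 1) ->
  derivable_upto N (derive1 f) -> derivable_upto N.+1 f.
Proof.
move=> df d [|k] x kN; first exact: df.
by rewrite derive1Sn; exact: d.
Qed.

Let derivable_uptoW N f : derivable_upto N.+1 f -> derivable_upto N f.
Proof. by move=> df k x kN; apply: df; rewrite (leq_trans kN). Qed.

Lemma derive1D_fun f g : (forall x : R, derivable f x 1) ->
  (forall x : R, derivable g x 1) ->
  derive1 (fun x => f x + g x) = fun x => derive1 f x + derive1 g x.
Proof.
move=> df dg; apply/funext => x; rewrite !derive1E.
exact: (deriveD (df x) (dg x)).
Qed.

Lemma derive1M_fun f g : (forall x : R, derivable f x 1) ->
  (forall x : R, derivable g x 1) ->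
  derive1 (fun x => f x * g x) = fun x => derive1 f x * g x + f x * derive1 g x.
Proof.
move=> df dg; apply/funext => x; rewrite !derive1E.
rewrite (deriveM (df x) (dg x)) addrC.
by congr (_ + _); rewrite /GRing.scale/= mulrC.
Qed.

Let derivable_uptoD N f g : derivable_upto N f -> derivable_upto N g ->
  derivable_upto N (fun x => f x + g x).
Proof.
elim: N f g => [|N IH] f g.
  move=> df dg k x; rewrite leqn0 => /eqP ->.
  exact: derivableD (df 0%N x (leqnn _)) (dg 0%N x (leqnn _)).
move=> /derivable_uptoS[df df'] /derivable_uptoS[dg dg'].
apply: derivable_upto_intro => [x|]; first exact: derivableD (df x) (dg x).
rewrite (derive1D_fun df dg); exact: IH df' dg'.
Qed.

Let derivable_uptoM N f g : derivable_upto N f -> derivable_upto N g ->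
  derivable_upto N (fun x => f x * g x).
Proof.
elim: N f g => [|N IH] f g.
  move=> df dg k x; rewrite leqn0 => /eqP ->.
  exact: derivableM (df 0%N x (leqnn _)) (dg 0%N x (leqnn _)).
move=> dfN dgN; have [df df'] := derivable_uptoS dfN.
have [dg dg'] := derivable_uptoS dgN.
apply: derivable_upto_intro => [x|]; first exact: derivableM (df x) (dg x).
rewrite (derive1M_fun df dg).
exact: derivable_uptoD (IH _ _ df' (derivable_uptoW dgN))
  (IH _ _ (derivable_uptoW dfN) dg').
Qed.

Lemma smoothM f g : smooth f -> smooth g -> smooth (fun x => f x * g x).
Proof.
move=> sf sg k x; apply: (@derivable_uptoM k f g _ _ k x (leqnn k)) => j z _.
  exact: sf.
exact: sg.
Qed.

Lemma is_derive_affine f (a b x : R) : derivable f (a * x + b) 1 ->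
  is_derive x (1 : R) (fun z : R => f (a * z + b)) (a * derive1 f (a * x + b)).
Proof.
move=> df.
have da : is_derive x (1 : R) (fun z : R => a * z + b) a.
  have h1 : is_derive x (1 : R) ( *%R a) a.
    have := is_deriveZ a (is_derive_id x (1 : R)).
    by rewrite /GRing.scale/= mulr1.
  by have := is_deriveD h1 (is_derive_cst b x (1 : R)); rewrite addr0.
have d : is_derive (a * x + b) (1 : R) f (derive1 f (a * x + b)).
  by rewrite derive1E; exact: derivableP df.
have H := @is_derive1_comp _ f (fun z : R => a * z + b) x _ _ d da.
by rewrite [a * derive1 _ _]mulrC.
Qed.

Lemma derivable_affine f (a b x : R) : derivable f (a * x + b) 1 ->
  derivable (fun z => f (a * z + b)) x 1.
Proof. by case/is_derive_affine. Qed.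

Lemma derive1_affine f (a b x : R) : derivable f (a * x + b) 1 ->
  derive1 (fun z => f (a * z + b)) x = a * derive1 f (a * x + b).
Proof. by rewrite [LHS]derive1E => /is_derive_affine[]. Qed.

Lemma smooth_affine f a b : smooth f -> smooth (fun x => f (a * x + b)).
Proof.
(* The free factor [c] absorbs the power of [a] produced by each differentiation, so the induction
   closes. *)
move=> sf; suff H : forall k (c : R) g, smooth g ->
    forall x : R, derivable (derive1n k (fun x => c * g (a * x + b))) x 1.
  move=> k x; have := H k 1 f sf x.
  by under eq_fun do rewrite mul1r.
elim=> [|k IH] c g sg x.
  have dg := derivable_affine (@smooth_derivable g (a * x + b) sg).
  exact: (derivableM (derivable_cst c x (1 : R)) dg).
rewrite derive1Sn [X in derive1n _ X](_ : _ =
    fun x => (c * a) * derive1 g (a * x + b)).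
  by apply: IH; exact: smooth_derive1.
apply/funext => z.
have d := @smooth_derivable g (a * z + b) sg.
by rewrite (derive1Ml _ (derivable_affine d)) (derive1_affine d) mulrA.
Qed.

End SmoothCalculus.

(** * Functions vanishing outside a bounded interval *)

Section CompactSupport.
Context {R : realType}.
Implicit Types (f g : R -> R) (M : R).

(** A quantitative substitute for compact support: it involves no closure, and the same [M] serves
    the derivative. *)
Definition vanishes_beyond M f := forall x, M < `|x| -> f x = 0.

(** The strict inequality cuts out an open set, so [f] agrees with [0] near each of its points. *)
Lemma vanishes_beyond_derive1 M f :
  vanishes_beyond M f -> vanishes_beyond M (derive1 f).
Proof.
move=> fM x Mx; rewrite derive1E (@near_eq_derive _ _ _ f (cst 0)).
  exact: derive_cst.
have /cvgr_gt/(_ _ Mx) : `|z| @[z --> x] --> `|x| by exact: norm_continuous.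
by apply: filterS => z; exact: fM.
Qed.

Lemma test_functionP f :
  test_function f <-> smooth f /\ exists M, vanishes_beyond M f.
Proof.
split=> [[sf /compact_bounded[M [Mreal fM]]]|[sf [M fM]]].
  split=> //; exists (M + 1) => x Mx; apply: contrapT => fx0.
  have M1 : M < M + 1 by rewrite ltrDl.
  have /= := fM _ M1 x (subset_closure _).
  by rewrite leNgt Mx => fx; have := fx (introN eqP fx0).
split=> //; apply: (subclosed_compact _ (@segment_compact _ (- M) M)).
  exact: closed_closure.
have /closure_id -> : closed `[(- M), M] by exact: interval_closed.
apply: closure_subset => x /= fx0; rewrite in_itv/= -ler_norml leNgt.
by apply/negP => /fM /eqP; rewrite (negbTE fx0).
Qed.

Lemma continuous_vanishes_beyond_bounded M f : continuous f ->
  vanishes_beyond M f -> exists2 K : R, 0 < K & forall x, `|f x| <= K.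
Proof.
move=> cf fM.
have /compact_bounded[K [Kreal fK]] : compact (f @` `[(- M), M]).
  apply: continuous_compact; first exact: continuous_subspaceT.
  exact: segment_compact.
exists (`|K| + 1) => [|x]; first by rewrite ltr_wpDl.
have [Mx|xM] := ltP M `|x|; first by rewrite fM// normr0 addr_ge0.
apply: fK; first by rewrite ltr_pwDr// ler_norm.
by exists x => //=; rewrite in_itv/= -ler_norml.
Qed.

Lemma lipschitz_of_derive1 (K : R) f : smooth f ->
  (forall x, `|derive1 f x| <= K) -> forall a b, `|f a - f b| <= K * `|a - b|.
Proof.
move=> sf fK a b; wlog ab : a b / a <= b.
  move=> H; have [/H//|/ltW/H] := leP a b.
  by rewrite distrC [in leRHS]distrC.
have df x : x \in `]a, b[ -> is_derive x 1 f (derive1 f x).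
  by move=> _; rewrite derive1E; apply: derivableP; exact: smooth_derivable.
have cf : {within `[a, b], continuous f}.
  by apply: continuous_subspaceT; exact: smooth_continuous.
have [c _ fab] := MVT_segment ab df cf.
by rewrite distrC fab normrM [`|b - a|]distrC ler_wpM2r.
Qed.

End CompactSupport.

(** * Lebesgue measure *)

Section Translation.
Context {R : realType}.
Notation mu := (@lebesgue_measure R).

Lemma measurable_shift (c : R) :
  measurable_fun setT ((fun x => x + c) : measurableTypeR R -> measurableTypeR R).
Proof. exact: measurable_funD. Qed.

Lemma lebesgue_measure_shift (c : R) (A : set R) : measurable A ->
  pushforward mu (fun x => x + c : measurableTypeR R) A = mu A.
Proof.
move=> mA; have mc := measurable_shift c.
apply/esym; apply: (@lebesgue_measure_unique _
  (pushforward mu (fun x => x + c : measurableTypeR R))) => //= _ [[a b]] _ <-.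
rewrite /pushforward (_ : _ @^-1` _ = `](a - c), (b - c)]%classic); last first.
  by apply/seteqP; split=> x /=; rewrite !in_itv/= ltrBlDr lerBrDr.
rewrite !lebesgue_measure_itv/= !lte_fin ltrD2r.
by case: ifP => // _; rewrite -!EFinB opprB addrA subrK.
Qed.

Lemma ge0_integral_shift (c : R) (D : set R) (f : R -> \bar R) : measurable D ->
  measurable_fun D f -> (forall x, D x -> 0 <= f x)%E ->
  (\int[mu]_(x in [set x : R | D (x + c)%R]) f ((x : R) + c)%R =
   \int[mu]_(x in D) f x)%E.
Proof.
move=> mD mf f0; have mc := measurable_shift c.
transitivity
  (\int[pushforward mu (fun x => (x + c)%R : measurableTypeR R)]_(x in D) f x)%E.
  rewrite ge0_integral_pushforward//.
  by move=> y; rewrite inE; exact: f0.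
apply: eq_measure_integral => //= A mA _; exact: lebesgue_measure_shift.
Qed.

Lemma ge0_integral_shiftT (c : R) (f : R -> \bar R) :
  measurable_fun setT f -> (forall x, 0 <= f x)%E ->
  (\int[mu]_x f ((x : R) + c)%R = \int[mu]_x f x)%E.
Proof.
move=> mf f0.
exact: (@ge0_integral_shift c setT f measurableT mf (fun x _ => f0 x)).
Qed.

(** Positive and negative parts are shifted separately, so both sides agree even where the integral
    takes a default value; measurability suffices. *)
Lemma Rintegral_shift (c : R) (f : R -> R) : measurable_fun setT f ->
  \int[mu]_x f ((x : R) + c) = \int[mu]_x f x.
Proof.
move=> mf; have mEf : measurable_fun setT (EFin \o f) by exact/measurable_EFinP.
have mp := measurable_funepos mEf; have mn := measurable_funeneg mEf.
rewrite /Rintegral integralE [in RHS]integralE.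
rewrite -(ge0_integral_shiftT c mp (funepos_ge0 _)).
rewrite -(ge0_integral_shiftT c mn (funeneg_ge0 _)).
by congr (fine (_ - _)); apply: eq_integral => x _; rewrite !unlock.
Qed.

End Translation.

(** * The two auxiliary functions *)

Section Cutoffs.
Context {R : realType}.
Notation mu := (@lebesgue_measure R).
Variables (chib theta : R -> R).

Section Chib.
Hypothesis hchib : is_cutoff_function chib.

Lemma cutoff_function_lipschitz a b : `|chib a - chib b| <= 2 * `|a - b|.
Proof.
case: hchib => sc _ _ dc; apply: lipschitz_of_derive1 => // x.
by case/andP: (dc x).
Qed.

Lemma cutoff_function_eq0 s : 2 < s -> chib s = 0.
Proof.
case: hchib => _ c0 _ _ s2; apply: c0.
by rewrite (lt_le_trans s2)// ler_norm.
Qed.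

(** Between 1 and 2 only the slope of [chib] is prescribed. Comparison with the zero value at 3, at
    slope 2, gives [2 * 3]. *)
Lemma cutoff_function_le6 s : 0 <= s -> `|chib s| <= 6.
Proof.
move=> s0; have [s2|s2] := ltP 2 s.
  by rewrite cutoff_function_eq0// normr0.
have := cutoff_function_lipschitz s 3.
rewrite [chib 3]cutoff_function_eq0 ?subr0; last lra.
rewrite [`|s - 3|]ltr0_norm; lra.
Qed.

End Chib.

Section Theta.
Hypothesis htheta : is_partition_generator theta.

Lemma partition_generator_support x :
  theta x != 0 -> - (1 / 4) < x < 5 / 4.
Proof.
case: htheta => _ _ st _ _ tx0.
by have /= := st _ (subset_closure (tx0 : [set x | theta x != 0] x)); rewrite in_itv.
Qed.

Lemma partition_generator_vanishes : vanishes_beyond 2 theta.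
Proof.
move=> x x2; apply/eqP/contraT => /partition_generator_support/andP[x1 x3].
by move: x2; rewrite lter_normr; lra.
Qed.

(** For these [t] the support condition puts [j] between -1/4 and 9/4, so only the terms 0, 1, 2 of
    the partition of unity survive. *)
Lemma partition_generator_sum3 t : 1 < t <= 2 ->
  theta t + theta (t - 1) + theta (t - 2) = 1.
Proof.
move=> /andP[t1 t2]; case: htheta => _ /(_ t) + _ _ _.
rewrite (@fsbigE _ _ _ _ _ [:: 0; 1; 2 : int])//=; last first.
  move=> i _ i3; apply/eqP/contraT => /partition_generator_support/andP[ti1 ti2].
  have : i%:~R < (3%:~R : R) by rewrite (_ : 3%:~R = 3)//; lra.
  have : ((-1)%:~R : R) < i%:~R by rewrite (_ : (-1)%:~R = -1)//; lra.
  rewrite !ltr_int; move: i3; rewrite !inE; lia.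
by rewrite !big_cons big_nil/= !in_setT subr0 addr0 addrA.
Qed.

Lemma measurable_partition_generator : measurable_fun setT theta.
Proof.
case: htheta => st _ _ _ _.
by apply: continuous_measurable_fun; exact: smooth_continuous.
Qed.

Lemma partition_generator_ge0 x : 0 <= theta x.
Proof. by case: htheta. Qed.

(** The support of [theta (x - y)] in [y] lies in three consecutive unit cells starting at [x - 2].
    Moving the last two onto the first makes the integrand the sum of three translates of [theta],
    which is 1 on a cell of length 1. *)
Lemma integral_partition_generator x :
  (\int[mu]_y (theta (x - y))%:E = 1)%E.
Proof.
pose D (k : R) : set R := `[x - 2 + k, x - 1 + k[%classic.
pose G (k y : R) : R := \1_(D k) y * theta (x - y).
have mt : measurable_fun setT (fun y : R => theta (x - y)).
  apply: (measurableT_comp measurable_partition_generator).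
  exact: measurable_funB.
have mG k : measurable_fun setT (fun y => (G k y)%:E).
  apply/measurable_EFinP; apply: measurable_funM => //.
  by apply: measurable_indic; exact: measurable_itv.
have G0 k y : (0 <= (G k y)%:E)%E.
  by rewrite lee_fin mulr_ge0// partition_generator_ge0.
transitivity (\int[mu]_y ((G 0 y)%:E + (G 1 y)%:E + (G 2 y)%:E))%E.
  apply: eq_integral => y _; rewrite -!EFinD -!mulrDl; congr EFin.
  have [->|/partition_generator_support/andP[y1 y2]] := eqVneq (theta (x - y)) 0.
    by rewrite mulr0.
  rewrite !indicE !mem_setE !in_itv/=.
  rewrite (_ : x - 2 + 0 <= y < x - 1 + 0 = (y < x - 1)); last first.
    by apply/idP/idP; lra.
  rewrite (_ : x - 2 + 1 <= y < x - 1 + 1 = (x - 1 <= y < x)); last first.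
    by apply/idP/idP; lra.
  rewrite (_ : x - 2 + 2 <= y < x - 1 + 2 = (x <= y)); last first.
    by apply/idP/idP; lra.
  case: (ltP y (x - 1)) => yx1 /=.
    rewrite (_ : x <= y = false) ?addr0 ?mul1r//; apply/negbTE; rewrite -ltNge; lra.
  by case: (ltP y x) => yx /=; rewrite ?addr0 ?add0r mul1r.
rewrite ge0_integralD//=; last 3 first.
- by move=> y _; rewrite adde_ge0.
- by apply: emeasurable_funD; exact: mG.
- exact: mG.
rewrite ge0_integralD//=; [|exact: mG..].
pose H (k y : R) : R := \1_(D 0%R) y * theta (x - (y + k)).
have H0 k y : (0 <= (H k y)%:E)%E.
  by rewrite lee_fin mulr_ge0// partition_generator_ge0.
have mH k : measurable_fun setT (fun y => (H k y)%:E).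
  apply/measurable_EFinP; apply: measurable_funM => //.
    by apply: measurable_indic; exact: measurable_itv.
  apply: (measurableT_comp measurable_partition_generator).
  by apply: measurable_funB => //; exact: measurable_funD.
have shiftG k : (\int[mu]_y (G k y)%:E = \int[mu]_y (H k y)%:E)%E.
  rewrite -(ge0_integral_shiftT k)//; apply: eq_integral => y _.
  congr (_ %:E); congr (_ * _); rewrite !indicE !mem_setE !in_itv/=.
  by congr (_%:R); congr (nat_of_bool (_ && _)); apply/idP/idP; lra.
have mHD : measurable_fun setT (fun y => (H 0 y)%:E + (H 1 y)%:E)%E.
  by apply: emeasurable_funD; exact: mH.
have HD0 y : (0 <= (H 0 y)%:E + (H 1 y)%:E)%E by rewrite adde_ge0.
rewrite !shiftG -!ge0_integralD//=; try exact: mH.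
transitivity (\int[mu]_y (\1_(D 0%R) y)%:E)%E.
  apply: eq_integral => y _; rewrite -!EFinD -!mulrDr; congr EFin.
  rewrite indicE mem_setE in_itv/=.
  have [/andP[y1 y2]|_] := boolP (_ <= y < _); last by rewrite mul0r.
  rewrite mul1r addr0 !(opprD y) !addrA partition_generator_sum3//; lra.
rewrite integral_indic ?setIT; [|exact: measurableT|exact: measurable_itv].
rewrite [LHS]lebesgue_measure_itv/= lte_fin ifT; last lra.
by rewrite -EFinB; congr EFin; lra.
Qed.

Lemma partition_generator_bound : exists2 M, 0 < M &
  forall x, `|theta x| <= M /\ `|derive1 theta x| <= M.
Proof.
have tv := partition_generator_vanishes.
case: htheta => st _ _ _ _.
have [M1 M10 M1t] := continuous_vanishes_beyond_bounded (smooth_continuous st) tv.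
have [M2 M20 M2t] := continuous_vanishes_beyond_bounded
  (smooth_continuous (smooth_derive1 st)) (vanishes_beyond_derive1 tv).
exists (M1 + M2) => [|x]; first exact: addr_gt0.
by split; [apply: (le_trans (M1t x))|apply: (le_trans (M2t x))];
  rewrite ?lerDl ?lerDr ltW.
Qed.

Lemma partition_generator_ge_half x : 0 <= x <= 1 -> 1 / 2 <= theta x.
Proof.
case: htheta => _ _ _ _ th x01.
have /th /= : (theta @` `[0, 1]) (theta x) by exists x => //=; rewrite in_itv.
by rewrite in_itv/= => /andP[].
Qed.

End Theta.
End Cutoffs.

(** * Locally integrable functions *)

Section AlmostEverywhere.
Context {R : realType}.
Notation mu := (@lebesgue_measure R).

Lemma ae_lebesgueS (P Q : R -> Prop) : (forall x, P x -> Q x) ->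
  (\forall x \ae mu, P x) -> \forall x \ae mu, Q x.
Proof. exact: (@filterS _ _ (ae_filter_ringOfSetsType mu)). Qed.

Lemma ae_lebesgue_ord n (P : 'I_n -> R -> Prop) :
  (forall i, \forall x \ae mu, P i x) -> \forall x \ae mu, forall i, P i x.
Proof. exact: (@filter_forall _ _ _ _ (ae_filter_ringOfSetsType mu)). Qed.

End AlmostEverywhere.

Section LocallyIntegrable.
Context {R : realType}.
Notation mu := (@lebesgue_measure R).
Implicit Types f g w : R -> R.

Lemma locally_integrableM f g : continuous g -> locally_integrable setT f ->
  locally_integrable setT (fun x => g x * f x).
Proof.
move=> cg [mf oT fK].
have mg : measurable_fun setT g by exact: continuous_measurable_fun.
split=> // [|K _ cK]; first exact: measurable_funM.
have mK := compact_measurable cK.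
have [C [Creal gC]] : bounded_set (g @` K).
  by apply/compact_bounded/continuous_compact => //; exact: continuous_subspaceT.
have mKf : measurable_fun K (fun x => `|f x|%:E).
  by apply/measurable_EFinP/measurableT_comp => //; exact: measurable_funTS.
have C0 : 0 <= `|C| + 1 by rewrite addr_ge0.
have gle x : K x -> `|g x| <= `|C| + 1.
  by move=> Kx; apply: gC; [rewrite ltr_pwDr// ler_norm|exists x].
apply: (@le_lt_trans _ _ ((`|C| + 1)%:E * \int[mu]_(x in K) `|f x|%:E)%E).
  rewrite -ge0_integralZl//; apply: ge0_le_integral => //.
  - apply/measurable_EFinP/measurableT_comp => //; apply: measurable_funTS.
    exact: measurable_funM.
  - by apply: measurable_funeM.
  - by move=> x Kx; rewrite -EFinM lee_fin normrM ler_wpM2r// gle.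
by rewrite lte_mul_pinfty// fK.
Qed.

Lemma integrable_locally_integrableM f g M : continuous g ->
  vanishes_beyond M g -> locally_integrable setT f ->
  mu.-integrable setT (fun x => (f x * g x)%:E).
Proof.
move=> cg gM lf; have [mgf _ gfK] := locally_integrableM cg lf.
rewrite (_ : (fun _ => _) = (fun x => (g x * f x)%:E) \_ `[(- M), M]); last first.
  apply/funext => x; rewrite patchE mem_setE in_itv/= -ler_norml mulrC.
  by case: leP => // /gM ->; rewrite mul0r.
apply: (iffLR (integrable_mkcond (mu:=mu) (D:=`[(- M), M]) _ (measurable_itv _))).
apply/integrableP; split.
  by apply/measurable_EFinP; exact: measurable_funTS.
by apply: gfK => //; exact: segment_compact.
Qed.

End LocallyIntegrable.

(** * The fundamental lemma of the calculus of variations *)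

Section Fundamental.
Context {R : realType}.
Notation mu := (@lebesgue_measure R).
Variable theta : R -> R.
Hypothesis htheta : is_partition_generator theta.

Let bump (x r y : R) := theta (r^-1 * y - r^-1 * x).

Let bump_vanishes (x r y : R) : 0 < r -> 2 * r < `|y - x| -> bump x r y = 0.
Proof.
move=> r0 yx; rewrite /bump -mulrBr; apply: partition_generator_vanishes => //.
by rewrite normrM normfV (gtr0_norm r0) mulrC ltr_pdivlMr.
Qed.

Let smooth_bump (x r : R) : smooth (bump x r).
Proof. by apply: smooth_affine; case: htheta. Qed.

Let bump_vanishes_beyond (x r : R) : 0 < r ->
  vanishes_beyond (2 * r + `|x|) (bump x r).
Proof.
move=> r0 y xy; apply: bump_vanishes => //.
by have := lerB_dist y x; lra.
Qed.

(** [theta >= 1/2] on [[0, 1]], which rescales to [[x, x + r]]. This lower bound replaces a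
    normalization of the bump. *)
Let integral_bump_ge (x r : R) : 0 < r ->
  ((r / 2)%:E <= \int[mu]_y (bump x r y)%:E)%E.
Proof.
move=> r0.
have <- : (\int[mu]_y (1 / 2 * \1_(`[x, x + r] : set R) y)%:E = (r / 2)%:E)%E.
  under eq_integral do rewrite EFinM.
  rewrite ge0_integralZl//; last first.
    by apply/measurable_EFinP/measurable_indic; exact: measurable_itv.
  rewrite integral_indic ?setIT; [|exact: measurableT|exact: measurable_itv].
  rewrite [X in (_ * X)%E]lebesgue_measure_itv/= lte_fin ltrDl r0.
  by rewrite -EFinB -EFinM; congr EFin; lra.
apply: ge0_le_integral => //.
- apply/measurable_EFinP; apply: measurable_funM => //.
- apply/measurable_EFinP; apply: continuous_measurable_fun.
  by apply: smooth_continuous; exact: smooth_bump.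
- move=> y _; rewrite lee_fin indicE mem_setE in_itv/=.
  have [/andP[y1 y2]|_] := boolP (_ <= _ <= _); last first.
    by rewrite mulr0; exact: (partition_generator_ge0 htheta).
  rewrite mulr1; apply: (partition_generator_ge_half htheta).
  rewrite -mulrBr mulrC; apply/andP; split.
    by rewrite divr_ge0// ?subr_ge0// ltW.
  by rewrite ler_pdivrMr// mul1r lerBlDl.
Qed.

(** Since [w] pairs to 0 with the bump [b], [|w x|] times the mass of [b] is the modulus of the
    integral of [(w y - w x) * b y]. The mass is at least [r / 2], and [b] is at most [M] and
    vanishes off the ball of radius [3 r], of length [6 r]: the quotient gives [12 * M]. *)
Lemma locally_integrable_bound w (x r M : R) : locally_integrable setT w ->
  (forall y, `|theta y| <= M) ->
  (forall phi, test_function phi -> \int[mu]_y (w y * phi y) = 0) ->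
  0 < r ->
  ((`|w x|)%:E <= (12 * M)%:E * davg w x (3 * r)%R)%E.
Proof.
move=> lw tM w0 r0; set b := bump x r.
have cb : continuous b by apply: smooth_continuous; exact: smooth_bump.
have vb := @bump_vanishes_beyond x r r0.
have b0 y : 0 <= b y by exact: (partition_generator_ge0 htheta).
have l1 : locally_integrable setT (cst (1 : R)).
  split; [exact: measurable_cst|exact: openT|move=> K _ cK].
  under eq_integral do rewrite normr1.
  rewrite (integral_cst mu (compact_measurable cK) 1%E) mul1e.
  exact: compact_finite_measure.
have iwb := integrable_locally_integrableM cb vb lw.
have ib : mu.-integrable setT (fun y => (b y)%:E).
  have := integrable_locally_integrableM cb vb l1.
  by under eq_fun do rewrite mul1r.
have icb : mu.-integrable setT (fun y => (w x * b y)%:E).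
  by under eq_fun do rewrite EFinM; exact: integrableZl.
have mw : measurable_fun setT w by case: lw.
have mb : measurable_fun setT b by exact: continuous_measurable_fun.
have M0 : 0 <= M by exact: le_trans (tM 0).
have mwb : measurable_fun setT (fun y => `|w y - w x|%:E).
  by apply/measurable_EFinP/measurableT_comp => //; exact: measurable_funB.
have e : (\int[mu]_y (w y * b y - w x * b y)%:E =
          - (w x)%:E * \int[mu]_y (b y)%:E)%E.
  rewrite (@integralB_EFin _ _ _ mu setT (fun y => w y * b y)
    (fun y => w x * b y) measurableT iwb icb).
  have tb : test_function b.
    by apply/test_functionP; split; [exact: smooth_bump|eexists; exact: vb].
  have -> : (\int[mu]_y (w y * b y)%:E)%E = 0%E.
    by rewrite -[LHS]fineK; [congr EFin; exact: w0|exact: integrable_fin_num].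
  under eq_integral do rewrite EFinM.
  by rewrite integralZl// sub0e mulNe.
have step : ((`|w x| * (r / 2))%:E <=
    M%:E * \int[mu]_(y in ball x (3 * r)) (`|w y - w x|)%:E)%E.
  apply: (@le_trans _ _ `|\int[mu]_y (w y * b y - w x * b y)%:E|%E).
    rewrite e abseM abseN EFinM; apply: lee_pmul => //.
      by rewrite lee_fin divr_ge0 ?ltW.
    exact: (le_trans (integral_bump_ge x r0) (lee_abs _)).
  have mwbb : measurable_fun setT (fun y => w y * b y - w x * b y).
    by apply: measurable_funB; exact: measurable_funM.
  apply: (le_trans (le_abse_integral _ _ _)) => //.
    exact/measurable_EFinP.
  rewrite -ge0_integralZl//; last 2 first.
  - exact: measurable_ball.
  - exact: measurable_funTS.
  rewrite [leRHS]integral_mkcond.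
  apply: ge0_le_integral => //.
  - exact/measurable_EFinP/measurableT_comp.
  - apply/(measurable_restrictT _ _).1; first exact: measurable_ball.
    by apply: measurable_funTS; exact: measurable_funeM.
  move=> y _; rewrite patchE; case: ifPn => [_|].
    rewrite lee_fin -mulrBl normrM mulrC ler_wpM2r//.
    exact: tM.
  rewrite notin_setE -ball_normE/= => /negP; rewrite -leNgt distrC => yx.
  have -> : b y = 0 by apply: bump_vanishes => //; lra.
  by rewrite !mulr0 subrr normr0.
rewrite /davg /iavg lebesgue_measure_ball; last by lra.
have -> : (`|w x|%:E = (2 / r)%:E * (`|w x| * (r / 2))%:E)%E.
  by rewrite -EFinM; congr EFin; field; rewrite gt_eqF.
rewrite inver ifF; last by apply/negbTE; rewrite gt_eqF//; lra.
rewrite [leRHS]muleA -[in leRHS]EFinM.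
rewrite (_ : 12 * M * (3 * r *+ 2)^-1 = 2 / r * M); last first.
  by rewrite -mulr_natr; field; rewrite gt_eqF.
rewrite [in leRHS]EFinM -muleA lee_wpmul2l// lee_fin divr_ge0// ltW//.
Qed.

(* The bump [theta((. - x) / r)] plays the role of a mollifier: at a Lebesgue
   point [x] of [w] its pairing with [w] is close to [w x] times its mass. *)
Lemma locally_integrable_eq0 w : locally_integrable setT w ->
  (forall phi, test_function phi -> \int[mu]_y (w y * phi y) = 0) ->
  {ae mu, forall x, w x = 0}.
Proof.
move=> lw w0; have [M M0 tM] := partition_generator_bound htheta.
apply: ae_lebesgueS (lebesgue_differentiation lw) => x wx.
have M12 : ((12 * M)%:E * davg w x r)%E @[r --> (0:R)^'+] --> 0%E.
  rewrite -(mule0 (12 * M)%:E); apply: cvgeZl => //.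
have bnd (r : R) : 0 < r -> (`|w x|%:E <= (12 * M)%:E * davg w x r)%E.
  move=> r0; have r3 : 0 < r / 3 by rewrite divr_gt0.
  have tM' y : `|theta y| <= M by case: (tM y).
  have := locally_integrable_bound x lw tM' w0 r3.
  by rewrite (_ : 3 * (r / 3) = r)//; field.
have : (`|w x|%:E <= 0)%E.
  apply: cvge_ge M12; near=> r; exact: bnd.
by rewrite lee_fin normr_le0 => /eqP.
Unshelve. all: by end_near. Qed.

End Fundamental.

(** * Weak derivatives *)

Section Sqnorm.
Context {R : realType} {n : nat}.
Implicit Types a b : 'rV[R]_n.

Lemma sqnorm_ge0 a : 0 <= sqnorm a.
Proof. by apply: sumr_ge0 => i _; exact: sqr_ge0. Qed.

Lemma sqnormZ (k : R) a : sqnorm (k *: a) = k ^+ 2 * sqnorm a.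
Proof. by rewrite /sqnorm mulr_sumr; apply: eq_bigr => i _; rewrite mxE exprMn. Qed.

Lemma sqnormN a : sqnorm (- a) = sqnorm a.
Proof. by apply: eq_bigr => i _; rewrite mxE sqrrN. Qed.

Lemma sqnorm0 : sqnorm (0 : 'rV[R]_n) = 0.
Proof. by rewrite /sqnorm big1// => i _; rewrite mxE expr0n. Qed.

(** Young's inequality; in each coordinate the difference of the two sides is a multiple of a
    square. The parameter [t] is kept free because optimizing it yields the triangle inequality of
    the integrated norms. *)
Lemma sqnormD_le (t : R) a b : 0 < t ->
  sqnorm (a + b) <= (1 + t) * sqnorm a + (1 + t^-1) * sqnorm b.
Proof.
move=> t0; rewrite /sqnorm !mulr_sumr -big_split/=; apply: ler_sum => i _.
rewrite mxE; set x := a 0 i; set y := b 0 i.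
rewrite -subr_ge0 (_ : _ - _ = t^-1 * (t * x - y) ^+ 2); last first.
  by field; rewrite gt_eqF.
by rewrite mulr_ge0 ?sqr_ge0 ?invr_ge0 ?ltW.
Qed.

Lemma sqnormD_le2 a b : sqnorm (a + b) <= 2 * sqnorm a + 2 * sqnorm b.
Proof. by have := sqnormD_le a b (@ltr01 R); rewrite invr1. Qed.

Lemma sqnormB_le2 a b : sqnorm (a - b) <= 2 * sqnorm a + 2 * sqnorm b.
Proof. by have := sqnormD_le2 a (- b); rewrite sqnormN. Qed.

End Sqnorm.

Lemma sqnorm_row_mx (R : realType) (m n : nat) (a : 'rV[R]_m) (b : 'rV[R]_n) :
  sqnorm (row_mx a b) = sqnorm a + sqnorm b.
Proof.
rewrite /sqnorm big_split_ord/=; congr (_ + _); apply: eq_bigr => i _.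
  by rewrite row_mxEl.
by rewrite row_mxEr.
Qed.

Lemma measurable_sqnorm d (T : measurableType d) (R : realType) (n : nat)
    (D : set T) (f : T -> 'rV[R]_n) :
  (forall i, measurable_fun D (fun x => f x 0 i)) ->
  measurable_fun D (fun x => sqnorm (f x)).
Proof.
move=> mf; apply: measurable_sum => i; exact: measurable_funX.
Qed.

Section WeakDerivative.
Context {R : realType} {n : nat}.
Notation mu := (@lebesgue_measure R).
Implicit Types (u v : R -> 'rV[R]_n) (a : R -> R) (y : R).

Lemma test_function_derive1_vanishes (phi : R -> R) : test_function phi ->
  [/\ continuous phi, continuous (derive1 phi) & exists M,
    vanishes_beyond M phi /\ vanishes_beyond M (derive1 phi)].
Proof.
move=> /test_functionP[sp [M pM]]; split.
- exact: smooth_continuous.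
- by apply: smooth_continuous; exact: smooth_derive1.
- by exists M; split=> //; exact: vanishes_beyond_derive1.
Qed.

Lemma L1locM a u : continuous a -> L1loc u -> L1loc (fun x => a x *: u x).
Proof.
move=> ca lu i; have := locally_integrableM ca (lu i).
by congr (locally_integrable _ _); apply/funext => x; rewrite mxE.
Qed.

Lemma L1locD u v : L1loc u -> L1loc v -> L1loc (fun x => u x + v x).
Proof.
move=> lu lv i; have := locally_integrableD (lu i) (lv i).
by congr (locally_integrable _ _); apply/funext => x; rewrite mxE.
Qed.

Lemma L1locB u v : L1loc u -> L1loc v -> L1loc (fun x => u x - v x).
Proof.
move=> lu lv i; have := locally_integrableB (lu i) (lv i).
by congr (locally_integrable _ _); apply/funext => x; rewrite !mxE.
Qed.

Lemma compact_shift (K : set R) y : compact K -> compact [set x | K (x + y)].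
Proof.
move=> cK.
rewrite (_ : [set x | _] = (fun x => x - y) @` K); last first.
  apply/seteqP; split=> x /=; first by exists (x + y) => //; rewrite addrK.
  by move=> [z Kz <-]; rewrite subrK.
apply: continuous_compact => //; apply: continuous_subspaceT => x.
by apply: cvgB => //; exact: cvg_cst.
Qed.

Lemma measurable_translate (f : R -> R) y :
  measurable_fun setT f -> measurable_fun setT (fun x : R => f (x - y)).
Proof.
by move=> mf; apply: (measurableT_comp mf); exact: measurable_funB.
Qed.

Lemma integral_compact_translate (f : R -> R) (K : set R) y : compact K ->
  measurable_fun setT f -> (forall x, 0 <= f x) ->
  (\int[mu]_(x in K) (f (x - y))%:E =
   \int[mu]_(x in [set x : R | K (x + y)%R]) (f x)%:E)%E.
Proof.
move=> cK mf f0.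
have mK := compact_measurable (compact_shift (y := y) cK).
rewrite -(ge0_integral_shift (- y) mK (f := EFin \o f)).
- by congr (integral _ _ _); apply/seteqP; split=> x /=; rewrite subrK.
- by apply/measurable_EFinP; exact: measurable_funTS.
- by move=> x _; rewrite lee_fin.
Qed.

Lemma locally_integrable_translate (f : R -> R) y :
  locally_integrable setT f -> locally_integrable setT (fun x => f (x - y)).
Proof.
move=> [mf oT fK]; split=> //; first exact: measurable_translate.
move=> K _ cK.
rewrite (integral_compact_translate (f := fun x => `|f x|) y cK)//.
  by apply: fK => //; exact: compact_shift.
exact: measurableT_comp.
Qed.

End WeakDerivative.

Section WeakDerivativeCalculus.
Context {R : realType} {n : nat}.
Notation mu := (@lebesgue_measure R).
Implicit Types (u v : R -> 'rV[R]_n) (a phi : R -> R) (y : R).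

Lemma integrable_L1loc_test u phi i : L1loc u -> test_function phi ->
  mu.-integrable setT (fun x => (u x 0 i * phi x)%:E) /\
  mu.-integrable setT (fun x => (u x 0 i * derive1 phi x)%:E).
Proof.
move=> lu tp; have [cp cp' [M [pM pM']]] := test_function_derive1_vanishes tp.
by split; [exact: integrable_locally_integrableM cp pM (lu i)
  |exact: integrable_locally_integrableM cp' pM' (lu i)].
Qed.

Lemma test_functionM a phi : smooth a -> test_function phi ->
  test_function (fun x => a x * phi x).
Proof.
move=> sa /test_functionP[sp [M pM]]; apply/test_functionP; split.
  exact: smoothM.
by exists M => x /pM ->; rewrite mulr0.
Qed.

(** [a * phi] is again a test function. Testing the identity for [u] with it produces the wanted
    terms, plus one with [derive1 a] that moves to the other side. *)
Lemma is_weak_derivativeM a u v : smooth a -> is_weak_derivative u v ->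
  is_weak_derivative (fun x => a x *: u x)
    (fun x => a x *: v x + derive1 a x *: u x).
Proof.
move=> sa [lu lv uv].
have ca := smooth_continuous sa.
have ca' := smooth_continuous (smooth_derive1 sa).
have lav := L1locM ca lv; have la'u := L1locM ca' lu.
split; [exact: L1locM|exact: L1locD|move=> phi i tp].
have tap := test_functionM sa tp.
have [_ iu] := integrable_L1loc_test i lu tap.
have [iv _] := integrable_L1loc_test i lv tap.
have [ia'u _] := integrable_L1loc_test i la'u tp.
have dp x : derivable phi x 1 by apply: smooth_derivable; case: tp.
have da x : derivable a x 1 by exact: smooth_derivable.
transitivity (\int[mu]_x (u x 0 i * derive1 (fun x => a x * phi x) x -
    (derive1 a x *: u x) 0 i * phi x)).
  apply: eq_Rintegral => x _; rewrite derive1M_fun// !mxE; ring.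
rewrite RintegralB// uv//.
transitivity (- \int[mu]_x (v x 0 i * (a x * phi x) +
    (derive1 a x *: u x) 0 i * phi x)).
  by rewrite RintegralD// opprD.
by congr (- _); apply: eq_Rintegral => x _; rewrite !mxE; ring.
Qed.

Lemma is_weak_derivativeB u v u' v' : is_weak_derivative u u' ->
  is_weak_derivative v v' ->
  is_weak_derivative (fun x => u x - v x) (fun x => u' x - v' x).
Proof.
move=> [lu lu' uu'] [lv lv' vv']; split; [exact: L1locB|exact: L1locB|].
move=> phi i tp.
have [_ iu] := integrable_L1loc_test i lu tp.
have [_ iv] := integrable_L1loc_test i lv tp.
have [iu' _] := integrable_L1loc_test i lu' tp.
have [iv' _] := integrable_L1loc_test i lv' tp.
transitivity (\int[mu]_x (u x 0 i * derive1 phi x - v x 0 i * derive1 phi x)).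
  by apply: eq_Rintegral => x _; rewrite !mxE mulrBl.
rewrite RintegralB// uu'// vv'// -opprD; congr (- _).
rewrite -[X in _ + X]opprK opprK -RintegralB//.
by apply: eq_Rintegral => x _; rewrite !mxE mulrBl.
Qed.

Lemma is_weak_derivative_translate y u v : is_weak_derivative u v ->
  is_weak_derivative (translate y u) (translate y v).
Proof.
move=> [lu lv uv]; split=> [i|i|phi i tp].
- exact: locally_integrable_translate (lu i).
- exact: locally_integrable_translate (lv i).
(* A change of variables moves the translation to the test function; the factor [1 *] fits the form
   of [smooth_affine]. *)
pose psi (x : R) := phi (1 * x + y).
have sp : smooth phi by case: tp.
have tpsi : test_function psi.
  apply/test_functionP; split; first exact: smooth_affine.
  have /test_functionP[_ [M pM]] := tp.
  exists (M + `|y|) => x xM; apply: pM; rewrite mul1r.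
  by have := lerB_normD x y; lra.
have dpsi x : derive1 psi x = derive1 phi (x + y).
  by rewrite derive1_affine ?mul1r//; exact: smooth_derivable.
have mp : measurable_fun setT phi.
  by apply: continuous_measurable_fun; exact: smooth_continuous.
have mp' : measurable_fun setT (derive1 phi).
  apply: continuous_measurable_fun; apply: smooth_continuous.
  exact: smooth_derive1.
have mu_ : measurable_fun setT (fun x => u x 0 i) by case: (lu i).
have mv_ : measurable_fun setT (fun x => v x 0 i) by case: (lv i).
rewrite -(Rintegral_shift y); last first.
  by apply: measurable_funM => //; exact: (@measurable_translate _ (fun x => u x 0 i) y mu_).
rewrite -[X in - X](Rintegral_shift y); last first.
  by apply: measurable_funM => //; exact: (@measurable_translate _ (fun x => v x 0 i) y mv_).
transitivity (\int[mu]_x (u x 0 i * derive1 psi x)).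
  by apply: eq_Rintegral => x _; rewrite dpsi /translate addrK.
rewrite uv//; congr (- _).
by apply: eq_Rintegral => x _; rewrite /psi /translate addrK mul1r.
Qed.

Lemma weakDP u v : is_weak_derivative u v -> is_weak_derivative u (weakD u).
Proof. by move=> uv; apply: (@xgetPex _ _ [set v | is_weak_derivative u v]); exists v. Qed.

Lemma is_weak_derivative_ae u u' v : u = u' %[ae mu] -> L1loc u' ->
  is_weak_derivative u v -> is_weak_derivative u' v.
Proof.
move=> uu' lu' [lu lv uv]; split=> // phi i tp.
rewrite -uv// /Rintegral; congr fine.
have [_ iu] := integrable_L1loc_test i lu tp.
have [_ iu'] := integrable_L1loc_test i lu' tp.
apply: ae_eq_integral => //.
- exact: measurable_int iu'.
- exact: measurable_int iu.
by apply: ae_lebesgueS uu' => x /[apply] ->.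
Qed.

Section Uniqueness.
Variable theta : R -> R.
Hypothesis htheta : is_partition_generator theta.

Lemma is_weak_derivative_unique u v w : is_weak_derivative u v ->
  is_weak_derivative u w -> \forall x \ae mu, v x = w x.
Proof.
move=> [lu lv uv] [_ lw uw].
have vw i : \forall x \ae mu, v x 0 i - w x 0 i = 0.
  apply: (locally_integrable_eq0 htheta); first exact: locally_integrableB.
  move=> phi tp.
  have [iv _] := integrable_L1loc_test i lv tp.
  have [iw _] := integrable_L1loc_test i lw tp.
  transitivity (\int[mu]_x (v x 0 i * phi x - w x 0 i * phi x)).
    by apply: eq_Rintegral => x _; rewrite mulrBl.
  by rewrite RintegralB// -[X in X - _]opprK -uv// uw// opprK subrr.
apply: ae_lebesgueS (ae_lebesgue_ord vw) => x vwx.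
by apply/rowP => i; apply/subr0_eq/vwx.
Qed.

Lemma weakD_unique u v : is_weak_derivative u v -> \forall x \ae mu, weakD u x = v x.
Proof. move=> uv; exact: is_weak_derivative_unique (weakDP uv) uv. Qed.

End Uniqueness.
End WeakDerivativeCalculus.

Section L2loc.
Context {R : realType} {n : nat}.
Notation mu := (@lebesgue_measure R).
Implicit Types (u v : R -> 'rV[R]_n) (a : R -> R) (y : R) (K : set R).

Let measurable_sqnorm_on (D : set R) u : L2loc u ->
  measurable_fun D (fun x => (sqnorm (u x))%:E).
Proof.
move=> [mu_ _]; apply/measurable_EFinP/measurable_sqnorm => i.
exact: measurable_funTS.
Qed.

Lemma L2locD u v : L2loc u -> L2loc v -> L2loc (fun x => u x + v x).
Proof.
move=> lu lv; have [mu_ uK] := lu; have [mv vK] := lv; split=> [i|K cK].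
  by under eq_fun do rewrite mxE; exact: measurable_funD.
have mK := compact_measurable cK.
have mD : measurable_fun K (fun x => (sqnorm (u x + v x))%:E).
  apply/measurable_EFinP/measurable_sqnorm => i; apply: measurable_funTS.
  by under eq_fun do rewrite mxE; exact: measurable_funD.
apply: (@le_lt_trans _ _ (\int[mu]_(x in K)
    (2%:E * (sqnorm (u x))%:E + 2%:E * (sqnorm (v x))%:E))%E).
  apply: ge0_le_integral => //.
  - by move=> x _; rewrite lee_fin sqnorm_ge0.
  - by apply: emeasurable_funD; apply: measurable_funeM; exact: measurable_sqnorm_on.
  - by move=> x _; rewrite -!EFinM -EFinD lee_fin sqnormD_le2.
rewrite ge0_integralD//; last 4 first.
- by move=> x _; rewrite mule_ge0// lee_fin sqnorm_ge0.
- by apply: measurable_funeM; exact: measurable_sqnorm_on.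
- by move=> x _; rewrite mule_ge0// lee_fin sqnorm_ge0.
- by apply: measurable_funeM; exact: measurable_sqnorm_on.
rewrite !ge0_integralZl//; try exact: measurable_sqnorm_on;
  try by move=> x _; rewrite lee_fin sqnorm_ge0.
by rewrite lte_add_pinfty// lte_mul_pinfty// ?uK// ?vK.
Qed.

Lemma L2locM a u : continuous a -> L2loc u -> L2loc (fun x => a x *: u x).
Proof.
move=> ca lu; have [mu_ uK] := lu.
have mau i : measurable_fun setT (fun x => (a x *: u x) 0 i).
  under eq_fun do rewrite mxE.
  by apply: measurable_funM => //; exact: continuous_measurable_fun.
split=> // K cK.
have mK := compact_measurable cK.
have [C [Creal aC]] : bounded_set (a @` K).
  by apply/compact_bounded/continuous_compact => //; exact: continuous_subspaceT.
apply: (@le_lt_trans _ _ (((`|C| + 1) ^+ 2)%:E *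
    \int[mu]_(x in K) (sqnorm (u x))%:E)%E).
  rewrite -ge0_integralZl//; last 2 first.
  - exact: measurable_sqnorm_on.
  - by move=> x _; rewrite lee_fin sqnorm_ge0.
  apply: ge0_le_integral => //.
  - by move=> x _; rewrite lee_fin sqnorm_ge0.
  - by apply/measurable_EFinP/measurable_sqnorm => i; exact: (measurable_funTS (mau i)).
  - by apply: measurable_funeM; exact: measurable_sqnorm_on.
  - move=> x Kx; rewrite -EFinM lee_fin sqnormZ ler_wpM2r ?sqnorm_ge0//.
    rewrite -[leLHS]ger0_norm ?sqr_ge0// normrX lerXn2r ?nnegrE//.
    by apply: aC; [rewrite ltr_pwDr// ler_norm|exists x].
by rewrite lte_mul_pinfty// ?uK// lee_fin sqr_ge0.
Qed.

Lemma L2locB u v : L2loc u -> L2loc v -> L2loc (fun x => u x - v x).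
Proof.
move=> lu lv; have : L2loc (fun x => u x + (-1) *: v x).
  have c1 : continuous (cst (-1) : R -> R) by move=> x; exact: cvg_cst.
  exact: L2locD lu (L2locM c1 lv).
by under eq_fun do rewrite scaleN1r.
Qed.

Lemma L2loc_translate y u : L2loc u -> L2loc (translate y u).
Proof.
move=> [mu_ uK]; split=> [i|K cK].
  exact: (@measurable_translate _ (fun x => u x 0 i) y (mu_ i)).
rewrite (integral_compact_translate (f := fun x => sqnorm (u x)))//.
- by apply: uK; exact: compact_shift.
- exact: measurable_sqnorm.
- by move=> x; exact: sqnorm_ge0.
Qed.

Lemma L2loc_ae u v : (\forall x \ae mu, u x = v x) ->
  (forall i, measurable_fun setT (fun x => v x 0 i)) -> L2loc u -> L2loc v.
Proof.
move=> uv mv lu; have [_ uK] := lu; split=> // K cK.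
rewrite (_ : (\int[mu]_(x in K) (sqnorm (v x))%:E =
              \int[mu]_(x in K) (sqnorm (u x))%:E)%E) ?uK//.
apply: ae_eq_integral.
- exact: compact_measurable.
- by apply/measurable_EFinP/measurable_sqnorm => i; exact: (measurable_funTS (mv i)).
- exact: measurable_sqnorm_on.
by apply: ae_lebesgueS uv => x ->.
Qed.

End L2loc.

(** * Local Sobolev functions with an explicit weak derivative *)

Section H1pair.
Context {R : realType} {n : nat}.
Notation mu := (@lebesgue_measure R).
Implicit Types (u v : R -> 'rV[R]_n) (a : R -> R) (y : R).

(** Keeping the derivative as data makes products, differences and translates explicit, which
    [weakD] does not allow. *)
Definition H1pair u du := [/\ is_weak_derivative u du, L2loc u & L2loc du].

Lemma H1pair_loc u du : H1pair u du -> H1loc u.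
Proof. by case=> ? ? ?; split=> //; exists du. Qed.

Lemma H1pairM a u du : smooth a -> H1pair u du ->
  H1pair (fun x => a x *: u x) (fun x => a x *: du x + derive1 a x *: u x).
Proof.
move=> sa [wu lu ldu].
have ca := smooth_continuous sa.
have ca' := smooth_continuous (smooth_derive1 sa).
by split; [exact: is_weak_derivativeM|exact: L2locM|
  apply: L2locD; exact: L2locM].
Qed.

Lemma H1pairB u du v dv : H1pair u du -> H1pair v dv ->
  H1pair (fun x => u x - v x) (fun x => du x - dv x).
Proof.
by move=> [wu lu ldu] [wv lv ldv]; split;
  [exact: is_weak_derivativeB|exact: L2locB|exact: L2locB].
Qed.

Lemma H1pair_translate y u du : H1pair u du ->
  H1pair (translate y u) (translate y du).
Proof.
by move=> [wu lu ldu]; split;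
  [exact: is_weak_derivative_translate|exact: L2loc_translate..].
Qed.

(** The comparison pair that turns estimates of differences into bounds for a single function. *)
Lemma H1pair0 : H1pair (fun=> 0 : 'rV[R]_n) (fun=> 0).
Proof.
have l1 : L1loc (fun=> 0 : 'rV[R]_n).
  move=> i; split=> //; first exact: openT.
  move=> K _ cK; rewrite (eq_integral (cst 0%E)) ?integral0// => x _.
  by rewrite mxE normr0.
have l2 : L2loc (fun=> 0 : 'rV[R]_n).
  split=> // K cK; rewrite (eq_integral (cst 0%E)) ?integral0// => x _.
  by rewrite sqnorm0.
split=> //; split=> // phi i _.
have z (f : R -> R) : \int[mu]_x ((0 : 'rV[R]_n) 0 i * f x) = 0.
  rewrite /Rintegral (eq_integral (cst 0%E)) ?integral0// => x _.
  by rewrite mxE mul0r.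
by rewrite !z oppr0.
Qed.

Section Norm.
Variable theta : R -> R.
Hypothesis htheta : is_partition_generator theta.

Lemma H1loc_pair u : H1loc u -> H1pair u (weakD u).
Proof.
move=> [lu [v [uv lv]]]; have wu := weakDP uv; split=> //.
apply: (L2loc_ae _ _ lv).
  by apply: (is_weak_derivative_unique htheta uv); exact: wu.
by move=> i; case: wu => _ /(_ i)[].
Qed.

(** Two weak derivatives differ on a null set only, so any of them may replace [weakD u] under the
    integral. *)
Lemma weighted_H1_normE (w : R -> R) (D : set R) u du : measurable D ->
  measurable_fun D w -> H1pair u du ->
  weighted_H1_norm w D u =
    ((\int[mu]_(x in D) (w x * (sqnorm (u x) + sqnorm (du x)))%:E) `^ 2^-1)%E.
Proof.
move=> mD mw pu; have [wu lu ldu] := pu.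
have [_ _ ldu'] := H1loc_pair (H1pair_loc pu).
have m v : L2loc v -> measurable_fun D (fun x => sqnorm (v x)).
  by move=> [mv _]; apply: measurable_sqnorm => i; exact: measurable_funTS.
congr (_ `^ _)%E; apply: ae_eq_integral => //.
- apply/measurable_EFinP; apply: measurable_funM => //.
  by apply: measurable_funD; exact: m.
- apply/measurable_EFinP; apply: measurable_funM => //.
  by apply: measurable_funD; exact: m.
by apply: ae_lebesgueS (weakD_unique htheta wu) => x ->.
Qed.

End Norm.
End H1pair.

(** * Convolution with a smooth bump *)

Section Convolution.
Context {R : realType}.
Notation mu := (@lebesgue_measure R).
Implicit Types (h f : R -> R).

Definition convolution h f (x : R) : R := \int[mu]_y (h y * f (x - y)).

Lemma is_derive_sub f (x y : R) : derivable f (x - y) 1 ->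
  is_derive x (1 : R) (fun z : R => f (z - y)) (derive1 f (x - y)).
Proof.
move=> df; have := @is_derive_affine _ f 1 (- y) x.
rewrite !mul1r => /(_ df).
by under [X in is_derive _ _ X]eq_fun do rewrite mul1r.
Qed.

Section Differentiation.
Variables (h : R -> R) (C : R).
Hypotheses (mh : measurable_fun setT h) (hC : forall y, `|h y| <= C).

Let locally_integrable_h : locally_integrable setT h.
Proof.
split=> //; first exact: openT.
move=> K _ cK; have mK := compact_measurable cK.
apply: (@le_lt_trans _ _ (\int[mu]_(x in K) (cst C%:E) x)%E).
  apply: ge0_le_integral => //.
  - apply/measurable_EFinP/measurableT_comp => //; exact: measurable_funTS.
  - by move=> x _; rewrite lee_fin.
rewrite integral_cst//; apply: lte_mul_pinfty => //.
  by rewrite lee_fin (le_trans _ (hC 0)).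
exact: compact_finite_measure.
Qed.

Lemma integrable_convolution f (M x : R) : continuous f -> vanishes_beyond M f ->
  mu.-integrable setT (fun y => (h y * f (x - y))%:E).
Proof.
move=> cf fM.
have cg : continuous (fun y : R => f (x - y)).
  move=> y; apply: (@continuous_comp _ _ _ (fun y : R => x - y) f).
    by apply: cvgB => //; exact: cvg_cst.
  exact: cf.
apply: (@integrable_locally_integrableM _ h (fun y => f (x - y)) (M + `|x|)) => //.
move=> y yM; apply: fM; rewrite distrC.
by have := lerB_dist y x; lra.
Qed.

Lemma is_derive_convolution f (M x : R) : smooth f -> vanishes_beyond M f ->
  derivable (convolution h f) x 1 /\
  derive1 (convolution h f) x = convolution h (derive1 f) x.
Proof.
move=> sf fM; have cf := smooth_continuous sf.
have cf' := smooth_continuous (smooth_derive1 sf).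
have f'M := vanishes_beyond_derive1 fM.
have [K K0 f'K] := continuous_vanishes_beyond_bounded cf' f'M.
have C0 : 0 <= C by rewrite (le_trans _ (hC 0)).
(* For [z] within 1 of [x], [derive1 f (z - y)] vanishes unless [y] lies in [J]; hence [C * K] on
   [J] dominates all the difference quotients' limits at once. *)
pose J : set R := `[x - 1 - `|M|, x + 1 + `|M|]%classic.
pose G (y : R) := C * K * \1_J y.
have Ix : x \in `](x - 1), (x + 1)[ by rewrite in_itv/=; lra.
have df (z y : R) : is_derive z (1 : R) (fun z : R => h y * f (z - y))
    (h y * derive1 f (z - y)).
  by apply: is_deriveZ; apply: is_derive_sub; exact: smooth_derivable.
have d1E (z y : R) : partial1of2 (fun z y => h y * f (z - y)) z y =
    h y * derive1 f (z - y).
  by rewrite partial1of2E; case: (df z y).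
have G0 y : 0 <= G y by rewrite !mulr_ge0// ltW.
have iG : mu.-integrable setT (EFin \o G).
  rewrite (_ : EFin \o G = (fun y => (C * K)%:E * (EFin \o \1_J) y)%E)//.
  by apply: integrableZl => //; exact: integrable_indic_itv.
have Gub (z y : R) : z \in `](x - 1), (x + 1)[ -> setT y ->
    `|partial1of2 (fun z y => h y * f (z - y)) z y| <= G y.
  move=> + _; rewrite d1E /G indicE mem_setE !in_itv/= => /andP[z1 z2].
  rewrite normrM; have [yJ|yJ] := boolP (_ <= y <= _).
    by rewrite mulr1; apply: ler_pM.
  rewrite [derive1 f _]f'M ?normr0 ?mulr0//.
  have := ler_norm M; have := ler_norm (z - y); have := ler_norm (y - z).
  rewrite distrC; lra.
have If (z : R) : z \in `](x - 1), (x + 1)[ ->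
    mu.-integrable setT (EFin \o (fun y => h y * f (z - y))).
  by move=> _; exact: integrable_convolution cf fM.
have Df (z y : R) : z \in `](x - 1), (x + 1)[ -> setT y ->
    derivable ((fun z y => h y * f (z - y)) ^~ y) z 1.
  by move=> _ _; case: (df z y).
split.
  exact: (@derivable_under_integral _ _ _ mu _ setT measurableT x _ _
    Ix If Df G G0 iG Gub).
rewrite [LHS](@differentiation_under_integral _ _ _ mu _ setT measurableT x _ _
  Ix If Df G G0 iG Gub).
by apply: eq_Rintegral => y _; exact: d1E.
Qed.

Lemma smooth_convolution f (M : R) : smooth f -> vanishes_beyond M f ->
  smooth (convolution h f).
Proof.
move=> sf fM k; elim: k f sf fM => [|k IH] f sf fM x.
  by case: (is_derive_convolution x sf fM).
rewrite derive1Sn (_ : derive1 (convolution h f) = convolution h (derive1 f)).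
  by apply: IH; [exact: smooth_derive1|exact: vanishes_beyond_derive1].
by apply/funext => z; case: (is_derive_convolution z sf fM).
Qed.

End Differentiation.
End Convolution.

(** * Kernel estimates *)

Section KernelEstimates.
Context {R : realType}.
Notation mu := (@lebesgue_measure R).

(* Integrate [2 c k <= k^2 + c^2], with [c] the mean of [k] over the interval of
   length 4 that carries [k]. *)
Lemma sqr_Rintegral_le (k : R -> R) (x : R) :
  mu.-integrable setT (EFin \o k) -> (forall y, 2 < `|x - y| -> k y = 0) ->
  (((\int[mu]_y k y) ^+ 2)%:E <= 4%:E * \int[mu]_y (k y ^+ 2)%:E)%E.
Proof.
move=> ik k0; set m := \int[mu]_y k y.
have mk : measurable_fun setT k by apply/measurable_EFinP; exact: measurable_int ik.
have mk2 : measurable_fun setT (fun y => (k y ^+ 2)%:E).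
  by apply/measurable_EFinP; exact: measurable_funX.
have k2ge0 y : (0 <= (k y ^+ 2)%:E)%E by rewrite lee_fin sqr_ge0.
have : (0 <= \int[mu]_y (k y ^+ 2)%:E)%E by exact: integral_ge0.
case E : (\int[mu]_y (k y ^+ 2)%:E)%E => [a| |]//; last first.
  by move=> _; rewrite mulry gtr0_sg// mul1e leey.
move=> _; rewrite -EFinM lee_fin.
pose I : set R := `[x - 2, x + 2]%classic.
have I4 : (\int[mu]_y (EFin \o \1_I) y = 4%:E)%E.
  rewrite integral_indic ?setIT; [|exact: measurableT|exact: measurable_itv].
  rewrite [LHS]lebesgue_measure_itv/= lte_fin ifT; last lra.
  by rewrite -EFinB; congr EFin; lra.
pose c := m / 4.
have ik2 : mu.-integrable setT (fun y => (k y ^+ 2)%:E).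
  apply/integrableP; split=> //.
  under eq_integral do rewrite gee0_abs//.
  by rewrite E ltry.
have iI : mu.-integrable setT (fun y => (c ^+ 2)%:E * (EFin \o \1_I) y)%E.
  by apply: integrableZl => //; exact: integrable_indic_itv.
have ick : mu.-integrable setT (fun y => (2 * c)%:E * (k y)%:E)%E.
  by apply: integrableZl.
have : (\int[mu]_y ((2 * c)%:E * (k y)%:E) <=
    \int[mu]_y ((k y ^+ 2)%:E + (c ^+ 2)%:E * (EFin \o \1_I) y))%E.
  apply: le_integral => //; first exact: integrableD.
  move=> y _; rewrite /= -EFinM -EFinM -EFinD lee_fin indicE mem_setE in_itv/=.
  have [yI|yI] := boolP (_ <= y <= _).
    rewrite mulr1 -subr_ge0 (_ : _ - _ = (k y - c) ^+ 2) ?sqr_ge0//; ring.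
  rewrite k0 ?mulr0 ?expr0n ?addr0//.
  have := ler_norm (x - y); have := ler_norm (y - x).
  by rewrite [`|y - x|]distrC; lra.
rewrite integralZl// integralD// E integralZl//; last exact: integrable_indic_itv.
rewrite I4.
have -> : (\int[mu]_y (k y)%:E = m%:E)%E.
  by rewrite -[LHS]fineK//; exact: integrable_fin_num.
rewrite -!EFinM -EFinD lee_fin /c; lra.
Qed.

(** After the order of integration is exchanged, [a x] is replaced by [b y] wherever [f x y] is
    nonzero. A weight thus passes from one variable to the other, provided the two are comparable on
    the support of [f]. *)
Lemma tonelli_weight (a b : R -> R) (f : R -> R -> R) :
  measurable_fun setT (fun z : R * R => f z.1 z.2) ->
  measurable_fun setT a -> measurable_fun setT b ->
  (forall x y, 0 <= f x y) -> (forall x, 0 <= a x) -> (forall y, 0 <= b y) ->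
  (forall x y, f x y != 0 -> a x <= b y) ->
  (\int[mu]_x ((a x)%:E * \int[mu]_y (f x y)%:E) <=
   \int[mu]_y ((b y)%:E * \int[mu]_x (f x y)%:E))%E.
Proof.
move=> mf ma mb f0 a0 b0 fab.
have Ef0 x y : (0 <= (f x y)%:E)%E by rewrite lee_fin.
have ml x : measurable_fun setT (fun y => (f x y)%:E).
  apply/measurable_EFinP.
  exact: (measurableT_comp mf (pair1_measurable x)).
have mr y : measurable_fun setT (fun x => (f x y)%:E).
  apply/measurable_EFinP.
  exact: (measurableT_comp mf (pair2_measurable y)).
have maf : measurable_fun setT (fun z : R * R => (a z.1 * f z.1 z.2)%:E).
  apply/measurable_EFinP; apply: measurable_funM => //.
  exact: (measurableT_comp ma measurable_fst).
have mbf : measurable_fun setT (fun z : R * R => (b z.2 * f z.1 z.2)%:E).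
  apply/measurable_EFinP; apply: measurable_funM => //.
  exact: (measurableT_comp mb measurable_snd).
rewrite [leLHS](_ : _ =
    (\int[mu]_x \int[mu]_y (a x * f x y)%:E)%E); last first.
  apply: eq_integral => x _; under [RHS]eq_integral do rewrite EFinM.
  by rewrite ge0_integralZl ?lee_fin//; exact: ml.
rewrite [leRHS](_ : _ =
    (\int[mu]_y \int[mu]_x (b y * f x y)%:E)%E); last first.
  apply: eq_integral => y _; under [RHS]eq_integral do rewrite EFinM.
  by rewrite ge0_integralZl ?lee_fin//; exact: mr.
rewrite (fubini_tonelli (m1 := mu) (m2 := mu)
  (fun z => (a z.1 * f z.1 z.2)%:E))//; last first.
  by move=> z; rewrite lee_fin mulr_ge0.
have le1 x y : a x * f x y <= b y * f x y.
  have [->|/fab ab] := eqVneq (f x y) 0; first by rewrite !mulr0.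
  by rewrite ler_wpM2r.
apply: ge0_le_integral => //.
- by move=> y _; apply: integral_ge0 => x _; rewrite lee_fin mulr_ge0.
- apply: (measurable_fun_fubini_tonelli_G (m1 := mu)
    (fun z => (a z.1 * f z.1 z.2)%:E)) => //.
  by move=> z; rewrite lee_fin mulr_ge0.
- apply: (measurable_fun_fubini_tonelli_G (m1 := mu)
    (fun z => (b z.2 * f z.1 z.2)%:E)) => //.
  by move=> z; rewrite lee_fin mulr_ge0.
- move=> y _; apply: ge0_le_integral => //.
  + by move=> x _; rewrite lee_fin mulr_ge0.
  + apply/measurable_EFinP; apply: measurable_funM => //.
    by apply/measurable_EFinP; exact: mr.
  + apply/measurable_EFinP; apply: measurable_funM => //.
    by apply/measurable_EFinP; exact: mr.
  + by move=> x _; rewrite lee_fin.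
Qed.

End KernelEstimates.

(** * The squared norm of a vector function and the truncation map *)

Section Energy.
Context {R : realType} {m : nat}.
Notation mu := (@lebesgue_measure R).
Implicit Types p q : R -> 'rV[R]_m.

(** The dimension [m] is arbitrary so that a function and its derivative, stacked in dimension
    [n + n], form one vector whose energy is a squared Sobolev norm. *)
Definition energy p : \bar R := (\int[mu]_x (sqnorm (p x))%:E)%E.

Definition measurable_rV p := forall i, measurable_fun setT (fun x => p x 0 i).

Lemma energy_ge0 p : (0 <= energy p)%E.
Proof. by apply: integral_ge0 => x _; rewrite lee_fin sqnorm_ge0. Qed.

Let measurable_Esqnorm p : measurable_rV p ->
  measurable_fun setT (fun x => (sqnorm (p x))%:E).
Proof. by move=> mp; apply/measurable_EFinP/measurable_sqnorm. Qed.

Lemma measurable_rVD p q : measurable_rV p -> measurable_rV q ->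
  measurable_rV (fun x => p x + q x).
Proof.
by move=> mp mq i; under eq_fun do rewrite mxE; exact: measurable_funD.
Qed.

Lemma measurable_rVZ (f : R -> R) p : measurable_fun setT f -> measurable_rV p ->
  measurable_rV (fun x => f x *: p x).
Proof.
by move=> mf mp i; under eq_fun do rewrite mxE; exact: measurable_funM.
Qed.

Lemma measurable_rVB p q : measurable_rV p -> measurable_rV q ->
  measurable_rV (fun x => p x - q x).
Proof.
move=> mp mq; apply: measurable_rVD => // i.
by under eq_fun do rewrite mxE; exact: measurableT_comp.
Qed.

Lemma energyD_le (s t : R) p q r : 0 <= s -> 0 <= t ->
  measurable_rV p -> measurable_rV q -> measurable_rV r ->
  (forall x, sqnorm (r x) <= s * sqnorm (p x) + t * sqnorm (q x)) ->
  (energy r <= s%:E * energy p + t%:E * energy q)%E.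
Proof.
move=> s0 t0 mp mq mr rpq.
have E0 p' x : (0 <= (sqnorm (p' x : 'rV[R]_m))%:E)%E by rewrite lee_fin sqnorm_ge0.
rewrite -!ge0_integralZl//; try exact: measurable_Esqnorm.
rewrite -ge0_integralD//; last 4 first.
- by move=> x _; rewrite mule_ge0.
- by apply: measurable_funeM; exact: measurable_Esqnorm.
- by move=> x _; rewrite mule_ge0.
- by apply: measurable_funeM; exact: measurable_Esqnorm.
apply: ge0_le_integral => //; first exact: measurable_Esqnorm.
  by apply: emeasurable_funD; apply: measurable_funeM; exact: measurable_Esqnorm.
by move=> x _; rewrite -!EFinM -EFinD lee_fin.
Qed.

Lemma energyC p q : energy (fun x => p x - q x) = energy (fun x => q x - p x).
Proof. by apply: eq_integral => x _; rewrite -sqnormN opprB. Qed.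

(** The optimal [t] is the quotient of the roots of [b] and [c], where the right-hand side becomes
    the square of their sum. Enlarging both roots by [e / 2] avoids division by zero. *)
Lemma sqrt_le_of_split (a b c : R) : 0 <= b -> 0 <= c ->
  (forall t, 0 < t -> a <= (1 + t) * c + (1 + t^-1) * b) ->
  Num.sqrt a <= Num.sqrt b + Num.sqrt c.
Proof.
move=> b0 c0 abc; apply/ler_addgt0Pl => e e0.
pose r := Num.sqrt b + e / 2; pose s := Num.sqrt c + e / 2.
have r0 : 0 < r by rewrite ltr_wpDl ?sqrtr_ge0// divr_gt0.
have s0 : 0 < s by rewrite ltr_wpDl ?sqrtr_ge0// divr_gt0.
have br : b <= r ^+ 2.
  by rewrite -[leLHS]sqr_sqrtr// lerXn2r ?nnegrE ?sqrtr_ge0 ?ltW// ltrDl divr_gt0.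
have cs : c <= s ^+ 2.
  by rewrite -[leLHS]sqr_sqrtr// lerXn2r ?nnegrE ?sqrtr_ge0 ?ltW// ltrDl divr_gt0.
have : a <= (r + s) ^+ 2.
  apply: (le_trans (abc _ (divr_gt0 r0 s0))).
  apply: (@le_trans _ _ ((1 + r / s) * s ^+ 2 + (1 + (r / s)^-1) * r ^+ 2)).
    by rewrite lerD// ler_wpM2l// addr_ge0// ?invr_ge0 divr_ge0// ltW.
  by rewrite le_eqVlt; apply/orP; left; apply/eqP; field; rewrite !gt_eqF.
move=> /ler_wsqrtr; rewrite sqrtr_sqr ger0_norm; last by rewrite addr_ge0 ?ltW.
by rewrite /r /s; lra.
Qed.

Lemma sqrt_energy_le p q (a b c : R) : measurable_rV p -> measurable_rV q ->
  energy p = a%:E -> energy q = b%:E ->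
  energy (fun x => p x - q x) = c%:E ->
  Num.sqrt a <= Num.sqrt b + Num.sqrt c.
Proof.
move=> mp mq pa qb pqc.
have a0 : 0 <= a by rewrite -lee_fin -pa energy_ge0.
have b0 : 0 <= b by rewrite -lee_fin -qb energy_ge0.
have c0 : 0 <= c by rewrite -lee_fin -pqc energy_ge0.
apply: sqrt_le_of_split => // t t0.
rewrite -lee_fin -pa EFinD !EFinM -pqc -qb.
apply: energyD_le => //.
- by rewrite addr_ge0// ltW.
- by rewrite addr_ge0// invr_ge0 ltW.
- exact: measurable_rVB.
- by move=> x; rewrite -{1}[p x](subrK (q x)); exact: sqnormD_le.
Qed.

Variable chib : R -> R.
Hypothesis hchib : is_cutoff_function chib.

Definition truncation (p : R -> 'rV[R]_m) : R := chib (Num.sqrt (fine (energy p))).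

Lemma truncation_le6 p : `|truncation p| <= 6.
Proof. by apply: (cutoff_function_le6 hchib); exact: sqrtr_ge0. Qed.

Lemma sqr_truncation_le36 p : truncation p ^+ 2 <= 36.
Proof.
have -> : 36 = 6 ^+ 2 :> R by ring.
by rewrite -[leLHS]ger0_norm ?sqr_ge0// normrX lerXn2r ?nnegrE// truncation_le6.
Qed.

(** Energy above 4 means norm above 2, outside the support of [chib]. Finiteness matters: [fine]
    sends [+oo] to 0, where [chib] is 1. *)
Lemma truncation_eq0 p : (4%:E < energy p < +oo)%E -> truncation p = 0.
Proof.
move=> /andP[p4 py]; apply: (cutoff_function_eq0 hchib).
have -> : 2 = Num.sqrt 4 :> R.
  by rewrite (_ : 4 = 2 ^+ 2); [rewrite sqrtr_sqr ger0_norm|ring].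
have pf : energy p = (fine (energy p))%:E.
  by rewrite fineK// ge0_fin_numE// energy_ge0.
move: p4; rewrite pf lte_fin => p4.
by rewrite ltr_sqrt// (lt_trans _ p4).
Qed.

(** The truncated vector is nonzero only if its norm is at most 2, and the factor is at most 6,
    whence 36 times 4. *)
Lemma truncation_energy_le p : (energy p < +oo)%E ->
  ((truncation p ^+ 2)%:E * energy p <= 144%:E)%E.
Proof.
move=> py; have [p4|p4] := ltP 4%:E (energy p).
  by rewrite truncation_eq0 ?p4// expr0n/= mul0e.
have -> : 144 = 36 * 4 :> R by ring.
rewrite [in leRHS]EFinM; apply: lee_pmul; rewrite ?energy_ge0 ?lee_fin ?sqr_ge0//.
exact: sqr_truncation_le36.
Qed.

(* [h_p p - h_q q = h_p (p - q) + (h_p - h_q) q], where the second term is small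
   because [h] is Lipschitz in the norm and [q] has norm at most 2. *)
Let truncation_lipschitz_aux p q : measurable_rV p -> measurable_rV q ->
  (energy p < +oo)%E -> (energy q <= 4%:E)%E ->
  (energy (fun x => (truncation p *: p x - truncation q *: q x)%R) <=
   104%:E * energy (fun x => (p x - q x)%R))%E.
Proof.
move=> mp mq py q4; have qy : (energy q < +oo)%E by rewrite (le_lt_trans q4)// ltry.
have mpq := measurable_rVB mp mq.
have cy : (energy (fun x => (p x - q x)%R) < +oo)%E.
  apply: (@le_lt_trans _ _ (2%:E * energy p + 2%:E * energy q)%E).
    by apply: energyD_le => // x; exact: sqnormB_le2.
  by rewrite lte_add_pinfty// lte_mul_pinfty.
have := energy_ge0 (fun x => p x - q x).
case Ec : (energy (fun x => p x - q x)) cy => [c| |] // _ c0.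
have := energy_ge0 p; have := energy_ge0 q.
case Ea : (energy p) py => [a| |]// _; case Eb : (energy q) q4 qy => [b| |]// q4 _.
rewrite !lee_fin in q4 c0 * => b0 a0.
set h := truncation p; set k := truncation q.
have hk : (h - k) ^+ 2 <= 4 * c.
  have s1 := sqrt_energy_le mp mq Ea Eb Ec.
  have s2 : Num.sqrt b <= Num.sqrt a + Num.sqrt c.
    by apply: (sqrt_energy_le mq mp Eb Ea); rewrite energyC.
  have := cutoff_function_lipschitz hchib (Num.sqrt a) (Num.sqrt b).
  rewrite -[chib (Num.sqrt a)]/(chib (Num.sqrt (fine a%:E))) -Ea -/(truncation p).
  rewrite -[chib (Num.sqrt b)]/(chib (Num.sqrt (fine b%:E))) -Eb -/(truncation q).
  rewrite -/h -/k => hk2.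
  have ab : `|Num.sqrt a - Num.sqrt b| <= Num.sqrt c by rewrite ler_norml; lra.
  have : `|h - k| <= 2 * Num.sqrt c by lra.
  move=> hk3; rewrite -[leLHS]ger0_norm ?sqr_ge0// normrX.
  have -> : 4 * c = (2 * Num.sqrt c) ^+ 2 by rewrite exprMn sqr_sqrtr//; ring.
  by rewrite lerXn2r// nnegrE mulr_ge0 ?sqrtr_ge0.
apply: (@le_trans _ _ ((2 * h ^+ 2)%:E * energy (fun x => p x - q x)%R +
    (2 * (h - k) ^+ 2)%:E * energy q)%E).
  apply: energyD_le => //.
  - by rewrite mulr_ge0 ?sqr_ge0.
  - by rewrite mulr_ge0 ?sqr_ge0.
  - by apply: measurable_rVB; exact: measurable_rVZ.
  move=> x; have -> : h *: p x - k *: q x = h *: (p x - q x) + (h - k) *: q x.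
    by rewrite scalerBr scalerBl addrA subrK.
  by rewrite (le_trans (sqnormD_le2 _ _))// !sqnormZ !mulrA.
(* With [h ^+ 2 <= 36], [(h - k) ^+ 2 <= 4 * c] and [b <= 4], the total is [72 * c + 32 * c], the
   constant 104. *)
rewrite Ec Eb -!EFinM -EFinD lee_fin.
have h36 := sqr_truncation_le36 p; rewrite -/h in h36.
have h1 : h ^+ 2 * c <= 36 * c by rewrite ler_wpM2r.
have h2 : (h - k) ^+ 2 * b <= 4 * c * 4 by apply: ler_pM => //; exact: sqr_ge0.
lra.
Qed.

(** The auxiliary estimate needs one function of norm at most 2, and the claim is symmetric in [p]
    and [q]. If both norms exceed 2, both truncations vanish. *)
Lemma truncation_lipschitz p q : measurable_rV p -> measurable_rV q ->
  (energy p < +oo)%E -> (energy q < +oo)%E ->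
  (energy (fun x => (truncation p *: p x - truncation q *: q x)%R) <=
   104%:E * energy (fun x => (p x - q x)%R))%E.
Proof.
move=> mp mq py qy.
have [q4|q4] := leP (energy q) 4%:E; first exact: truncation_lipschitz_aux.
have [p4|p4] := leP (energy p) 4%:E.
  rewrite (energyC (fun x => truncation p *: p x)) (energyC p q).
  exact: truncation_lipschitz_aux.
rewrite !truncation_eq0 ?p4 ?q4//.
rewrite (_ : energy _ = 0%E) ?mule_ge0 ?energy_ge0//.
rewrite /energy (eq_integral (cst 0%E)) ?integral0// => x _.
by rewrite !scale0r subr0 sqnorm0.
Qed.

End Energy.

Section VectorKernel.
Context {R : realType} {m : nat}.
Notation mu := (@lebesgue_measure R).

(** The factor 4 is the length of the [y]-interval carrying the kernel, from Cauchy-Schwarz applied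
    in each coordinate. The weights [w] and [W] stay abstract so as to cover both exponential
    weights and indicators of intervals. *)
Lemma kernel_estimate (K : R -> R -> 'rV[R]_m) (X : R -> 'rV[R]_m)
    (w W : R -> R) :
  (forall k, measurable_fun setT (fun z : R * R => K z.1 z.2 0 k)) ->
  (forall y x, 2 < `|x - y| -> K y x = 0) ->
  (forall x k, mu.-integrable setT (fun y => (K y x 0 k)%:E)) ->
  measurable_rV X ->
  (forall x k, X x 0 k = \int[mu]_y K y x 0 k) ->
  measurable_fun setT w -> measurable_fun setT W ->
  (forall x, 0 <= w x) -> (forall y, 0 <= W y) ->
  (forall x y, `|x - y| <= 2 -> w x <= W y) ->
  (\int[mu]_x (w x * sqnorm (X x))%:E <=
   4%:E * \int[mu]_y ((W y)%:E * energy (K y)))%E.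
Proof.
move=> mK K0 iK mX XE mw mW w0 W0 wW.
have mf : measurable_fun setT (fun z : R * R => sqnorm (K z.2 z.1)).
  apply: measurable_sqnorm => k.
  have mKk := measurableT_comp (mK k) (@measurable_swap _ _ R R).
  exact: mKk.
have f0 x y : 0 <= sqnorm (K y x) by exact: sqnorm_ge0.
have CS x : ((sqnorm (X x))%:E <= 4%:E * \int[mu]_y (sqnorm (K y x))%:E)%E.
  rewrite /sqnorm -sumEFin.
  under [in leRHS]eq_integral do rewrite -sumEFin.
  have mKx k : measurable_fun setT (fun y => ((K y x 0 k) ^+ 2)%:E).
    apply/measurable_EFinP/measurable_funX/measurable_EFinP.
    exact: measurable_int (iK x k).
  rewrite ge0_integral_sum//; last by move=> k y _; rewrite lee_fin sqr_ge0.
  rewrite ge0_sume_distrr; last first.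
    by move=> k _; apply: integral_ge0 => y _; rewrite lee_fin sqr_ge0.
  apply: lee_sum => k _; rewrite XE.
  apply: (@sqr_Rintegral_le _ (fun y => K y x 0 k) x (iK x k)) => y xy.
  by rewrite K0// mxE.
have mF : measurable_fun setT (fun x => \int[mu]_y (sqnorm (K y x))%:E)%E.
  apply: (measurable_fun_fubini_tonelli_F (m2 := mu)
    (fun z => (sqnorm (K z.2 z.1))%:E)).
    exact/measurable_EFinP.
  by move=> z; rewrite lee_fin.
have F0 x : (0 <= \int[mu]_y (sqnorm (K y x))%:E)%E.
  by apply: integral_ge0 => y _; rewrite lee_fin.
have mEw : measurable_fun setT (fun x => (w x)%:E) by exact/measurable_EFinP.
apply: (@le_trans _ _ (4%:E *
    \int[mu]_x ((w x)%:E * \int[mu]_y (sqnorm (K y x))%:E))%E).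
  rewrite -ge0_integralZl//; last 2 first.
  - exact: emeasurable_funM.
  - by move=> x _; rewrite mule_ge0// lee_fin.
  apply: ge0_le_integral => //.
  - by move=> x _; rewrite lee_fin mulr_ge0// sqnorm_ge0.
  - by apply/measurable_EFinP; apply: measurable_funM => //; exact: measurable_sqnorm.
  - by apply: measurable_funeM; exact: emeasurable_funM.
  - by move=> x _; rewrite EFinM muleCA lee_wpmul2l// lee_fin.
apply: lee_wpmul2l; first by rewrite lee_fin.
apply: (tonelli_weight (f := fun x y => sqnorm (K y x))) => // x y fxy.
apply: wW; rewrite leNgt; apply/negP => /K0 Kxy.
by move: fxy; rewrite Kxy sqnorm0 eqxx.
Qed.

End VectorKernel.

(** * Localized functions paired with their derivatives *)

Section Jet.
Context {R : realType} {n : nat}.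
Notation mu := (@lebesgue_measure R).
Implicit Types u v du dv : R -> 'rV[R]_n.
Variable theta : R -> R.

(* When [du] is the weak derivative of [u], [jet u du y] pairs the localized
   function [theta(. - y) u] with its weak derivative. *)
Definition jet u du (y x : R) : 'rV[R]_(n + n) :=
  row_mx (theta (x - y) *: u x)
         (theta (x - y) *: du x + derive1 theta (x - y) *: u x).

Lemma jetB u du v dv y x :
  jet (fun x => u x - v x) (fun x => du x - dv x) y x =
  jet u du y x - jet v dv y x.
Proof.
rewrite /jet opp_row_mx add_row_mx !scalerBr opprD addrACA.
by congr (row_mx _ (_ + _)); rewrite addrC.
Qed.

Lemma jet_translate z u du y x :
  jet (translate z u) (translate z du) y x = jet u du (y - z) (x - z).
Proof. by rewrite /jet /translate (_ : x - z - (y - z) = x - y)//; ring. Qed.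

Hypothesis htheta : is_partition_generator theta.

Let st : smooth theta. Proof. by case: htheta. Qed.

Lemma jet_eq0 u du y x : 2 < `|x - y| -> jet u du y x = 0.
Proof.
move=> xy; have tv := partition_generator_vanishes htheta.
rewrite /jet tv// (vanishes_beyond_derive1 tv)//.
by rewrite !scale0r addr0 row_mx0.
Qed.

Lemma sqnorm_jet_le (M : R) u du y x :
  (forall x, `|theta x| <= M /\ `|derive1 theta x| <= M) ->
  sqnorm (jet u du y x) <= 4 * M ^+ 2 * (sqnorm (u x) + sqnorm (du x)).
Proof.
move=> tM; have [t1 t2] := tM (x - y).
have M0 : 0 <= M by exact: le_trans t1.
have sq a : `|a| <= M -> a ^+ 2 <= M ^+ 2.
  by move=> aM; rewrite -[leLHS]ger0_norm ?sqr_ge0// normrX lerXn2r ?nnegrE.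
rewrite sqnorm_row_mx.
(* The coefficients are [3 * M ^+ 2] for [u] and [2 * M ^+ 2] for [du], both rounded up to
   [4 * M ^+ 2]. *)
apply: (@le_trans _ _ (M ^+ 2 * sqnorm (u x) +
    (2 * (M ^+ 2 * sqnorm (du x)) + 2 * (M ^+ 2 * sqnorm (u x))))).
  apply: lerD; first by rewrite sqnormZ ler_wpM2r ?sqnorm_ge0 ?sq.
  apply: (le_trans (sqnormD_le2 _ _)).
  by rewrite !sqnormZ; apply: lerD; rewrite ler_wpM2l// ler_wpM2r ?sqnorm_ge0 ?sq.
have : 0 <= M ^+ 2 * sqnorm (u x) by rewrite mulr_ge0 ?sqr_ge0 ?sqnorm_ge0.
have : 0 <= M ^+ 2 * sqnorm (du x) by rewrite mulr_ge0 ?sqr_ge0 ?sqnorm_ge0.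
lra.
Qed.

Lemma measurable_jet u du k : measurable_rV u -> measurable_rV du ->
  measurable_fun setT (fun z : R * R => jet u du z.1 z.2 0 k).
Proof.
move=> mu_ mdu.
have mt (f : R -> R) : continuous f ->
    measurable_fun setT (fun z : R * R => f (z.2 - z.1)).
  move=> /continuous_measurable_fun mf; apply: (measurableT_comp mf).
  exact: measurable_funB measurable_snd measurable_fst.
have mt0 := mt _ (smooth_continuous st).
have mt1 := mt _ (smooth_continuous (smooth_derive1 st)).
have m2 (f : R -> R) : measurable_fun setT f ->
    measurable_fun setT (fun z : R * R => f z.2).
  by move=> mf; exact: (measurableT_comp mf measurable_snd).
have E i (z : R * R) : jet u du z.1 z.2 0 (lshift n i) =
    theta (z.2 - z.1) * u z.2 0 i.
  by rewrite row_mxEl mxE.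
have E' i (z : R * R) : jet u du z.1 z.2 0 (rshift n i) =
    theta (z.2 - z.1) * du z.2 0 i + derive1 theta (z.2 - z.1) * u z.2 0 i.
  by rewrite row_mxEr !mxE.
case: (split_ordP k) => i ->.
  under eq_fun do rewrite E.
  exact: measurable_funM mt0 (m2 _ (mu_ i)).
under eq_fun do rewrite E'.
exact: measurable_funD (measurable_funM mt0 (m2 _ (mdu i)))
  (measurable_funM mt1 (m2 _ (mu_ i))).
Qed.

Lemma measurable_jet_x u du y : measurable_rV u -> measurable_rV du ->
  measurable_rV (jet u du y).
Proof.
move=> mu_ mdu k.
exact: (measurableT_comp (measurable_jet k mu_ mdu) (pair1_measurable y)).
Qed.

Lemma measurable_energy_jet u du : measurable_rV u -> measurable_rV du ->
  measurable_fun setT (fun y => energy (jet u du y)).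
Proof.
move=> mu_ mdu.
apply: (measurable_fun_fubini_tonelli_F (m2 := mu)
  (fun z => (sqnorm (jet u du z.1 z.2))%:E)).
  by apply/measurable_EFinP/measurable_sqnorm => k; exact: measurable_jet.
by move=> z; rewrite lee_fin sqnorm_ge0.
Qed.

End Jet.

(** * The cut-off operator *)

Section Cutoff.
Context {R : realType} {n : nat}.
Notation mu := (@lebesgue_measure R).
Implicit Types u v du dv : R -> 'rV[R]_n.
Variables chib theta : R -> R.
Hypothesis hchib : is_cutoff_function chib.
Hypothesis htheta : is_partition_generator theta.

Let st : smooth theta. Proof. by case: htheta. Qed.
Let tv := partition_generator_vanishes htheta.

(** The weight of the operator computed from an explicit derivative; [cutoff_weightE] identifies it
    with the one built on [H1_norm]. *)
Definition cutoff_weight u du (y : R) : R := truncation chib (jet theta u du y).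

(** The product rule for the smooth convolution times [u], with the derivative of the convolution
    placed on [theta]. *)
Definition dcutoff u du (x : R) : 'rV[R]_n :=
  convolution (cutoff_weight u du) theta x *: du x +
  convolution (cutoff_weight u du) (derive1 theta) x *: u x.

Lemma H1pair_measurable u du : H1pair u du -> measurable_rV u /\ measurable_rV du.
Proof. by case=> _ [mu_ _] [mdu _]. Qed.

(** The jet lives on the compact interval [[y - 2, y + 2]], so local square integrability is enough,
    whatever the growth of [u]. *)
Lemma energy_jet_lty u du y : H1pair u du -> (energy (jet theta u du y) < +oo)%E.
Proof.
move=> pu; have [mu_ mdu] := H1pair_measurable pu.
have [_ [_ uK] [_ duK]] := pu.
have [M M0 tM] := partition_generator_bound htheta.
pose I : set R := `[y - 2, y + 2]%classic.
have mI : measurable I by exact: measurable_itv.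
have cI : compact I by exact: segment_compact.
have mS (p : R -> 'rV[R]_n) : measurable_rV p ->
    measurable_fun I (fun x => (sqnorm (p x))%:E).
  move=> mp; apply/measurable_EFinP/measurable_sqnorm => i.
  exact: (measurable_funTS (mp i)).
have S0 (p : R -> 'rV[R]_n) x : (0 <= (sqnorm (p x))%:E)%E.
  by rewrite lee_fin sqnorm_ge0.
have C0 : 0 <= 4 * M ^+ 2 by rewrite mulr_ge0 ?sqr_ge0.
apply: (@le_lt_trans _ _ ((4 * M ^+ 2)%:E *
    (\int[mu]_(x in I) ((sqnorm (u x))%:E + (sqnorm (du x))%:E)))%E).
  rewrite -ge0_integralZl//; last 2 first.
  - by apply: emeasurable_funD; exact: mS.
  - by move=> x _; rewrite adde_ge0.
  rewrite [leRHS]integral_mkcond; apply: ge0_le_integral => //.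
  - by move=> x _; rewrite lee_fin sqnorm_ge0.
  - apply/measurable_EFinP/measurable_sqnorm; exact: measurable_jet_x.
  - apply/(measurable_restrictT _ _).1 => //.
    by apply: measurable_funeM; apply: emeasurable_funD; exact: mS.
  - move=> x _; rewrite patchE mem_setE in_itv/=.
    have [yI|yI] := boolP (_ <= x <= _).
      by rewrite -EFinD -EFinM lee_fin sqnorm_jet_le.
    rewrite jet_eq0 ?sqnorm0//.
    have := ler_norm (x - y); have := ler_norm (y - x).
    by rewrite [`|y - x|]distrC; lra.
rewrite ge0_integralD//; [|exact: mS..].
rewrite lte_mul_pinfty//.
by apply: lte_add_pinfty; [exact: uK|exact: duK].
Qed.

Lemma H1pair_localize u du y : H1pair u du ->
  H1pair (localize theta y u)
    (fun x => theta (x - y) *: du x + derive1 theta (x - y) *: u x).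
Proof.
move=> pu.
have da (x : R) : derive1 (fun z => theta (z - y)) x = derive1 theta (x - y).
  rewrite [LHS]derive1E.
  by have [_ ->] := is_derive_sub (smooth_derivable (x := x - y) st).
have sa : smooth (fun z => theta (z - y)).
  have := @smooth_affine _ theta 1 (- y) st.
  by under eq_fun do rewrite mul1r.
by have := H1pairM sa pu; under [X in H1pair _ X]eq_fun do rewrite da.
Qed.

Lemma H1_norm_localize u du y : H1pair u du ->
  H1_norm (localize theta y u) = (energy (jet theta u du y) `^ 2^-1)%E.
Proof.
move=> pu; rewrite /H1_norm /H1_norm_on.
rewrite (weighted_H1_normE htheta _ _ (H1pair_localize y pu))//.
congr (_ `^ _)%E; apply: eq_integral => x _.
by rewrite mul1r sqnorm_row_mx.
Qed.

Lemma H1_localize u y : H1loc u -> H1 (localize theta y u).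
Proof.
move=> /(H1loc_pair htheta) pu.
split; first exact: H1pair_loc (H1pair_localize y pu).
by rewrite (H1_norm_localize y pu); apply: poweR_lty; exact: energy_jet_lty.
Qed.

Lemma cutoff_weightE u du y : H1pair u du ->
  chib (fine (H1_norm (localize theta y u))) = cutoff_weight u du y.
Proof.
move=> pu; rewrite (H1_norm_localize y pu) fine_poweR powR12_sqrt//.
exact/fine_ge0/energy_ge0.
Qed.

(** Jet energies are measurable in [y] as partial integrals of a jointly measurable function. With
    the bound 6, this is all that the convolution asks of the weight. *)
Lemma measurable_cutoff_weight u du : H1pair u du ->
  measurable_fun setT (cutoff_weight u du).
Proof.
move=> /H1pair_measurable[mu_ mdu].
have mc : measurable_fun setT chib.
  apply: continuous_measurable_fun; apply: smooth_continuous; by case: hchib.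
apply: (measurableT_comp mc).
apply: (measurableT_comp (continuous_measurable_fun (@sqrt_continuous R))).
apply: (measurableT_comp (fine_measurable measurableT)).
exact: measurable_energy_jet.
Qed.

Lemma cutoff_weight_le6 u du y : `|cutoff_weight u du y| <= 6.
Proof. exact: truncation_le6. Qed.

Lemma integrable_cutoff_weight u du f (M x : R) : H1pair u du -> continuous f ->
  vanishes_beyond M f ->
  mu.-integrable setT (fun y => (cutoff_weight u du y * f (x - y))%:E).
Proof.
move=> pu cf fM.
exact: (@integrable_convolution _ _ _ (measurable_cutoff_weight pu)
  (@cutoff_weight_le6 u du) f M x cf fM).
Qed.

Lemma cutoff_integrandE u du x i : H1pair u du ->
  cutoff_integrand chib theta u x i =
  fun y => cutoff_weight u du y * theta (x - y) * u x 0 i.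
Proof.
by move=> pu; apply/funext => y; rewrite /cutoff_integrand (cutoff_weightE y pu).
Qed.

Lemma integrable_cutoff_integrand u x i : H1loc u ->
  mu.-integrable setT (fun y => (cutoff_integrand chib theta u x i y)%:E).
Proof.
move=> /(H1loc_pair htheta) pu; rewrite (cutoff_integrandE x i pu).
under eq_fun do rewrite EFinM.
apply: integrableZr => //.
exact: integrable_cutoff_weight pu (smooth_continuous st) tv.
Qed.

Lemma cutoffE u du : H1pair u du ->
  cutoff chib theta u = fun x => convolution (cutoff_weight u du) theta x *: u x.
Proof.
move=> pu; apply/funext => x; apply/rowP => i.
rewrite !mxE (cutoff_integrandE x i pu) RintegralZr//.
exact: integrable_cutoff_weight pu (smooth_continuous st) tv.
Qed.

Lemma H1pair_cutoff u du : H1pair u du ->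
  H1pair (cutoff chib theta u) (dcutoff u du).
Proof.
move=> pu; have mh := measurable_cutoff_weight pu.
have hC := @cutoff_weight_le6 u du.
have := H1pairM (smooth_convolution mh hC st tv) pu.
rewrite -(cutoffE pu); congr (H1pair _ _); apply/funext => x.
by have [_ ->] := is_derive_convolution mh hC x st tv.
Qed.

Lemma integrable_jet u du x k : H1pair u du ->
  mu.-integrable setT
    (fun y => ((cutoff_weight u du y *: jet theta u du y x) 0 k)%:E).
Proof.
move=> pu.
have i0 := integrable_cutoff_weight x pu (smooth_continuous st) tv.
have i1 := integrable_cutoff_weight x pu
  (smooth_continuous (smooth_derive1 st)) (vanishes_beyond_derive1 tv).
case: (split_ordP k) => i ->.
  rewrite (_ : (fun _ => _) =
    (fun y => (cutoff_weight u du y * theta (x - y))%:E *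
      (u x 0 i)%:E)%E); last first.
    by apply/funext => y; rewrite mxE row_mxEl mxE -EFinM mulrA.
  exact: integrableZr.
rewrite (_ : (fun _ => _) =
  ((fun y => (cutoff_weight u du y * theta (x - y))%:E * (du x 0 i)%:E) \+
   (fun y => (cutoff_weight u du y * derive1 theta (x - y))%:E *
      (u x 0 i)%:E))%E); last first.
  by apply/funext => y; rewrite mxE row_mxEr !mxE/= -!EFinM -EFinD mulrDr !mulrA.
by apply: integrableD => //; exact: integrableZr.
Qed.

Lemma row_mx_cutoffE u du x k : H1pair u du ->
  row_mx (cutoff chib theta u x) (dcutoff u du x) 0 k =
  \int[mu]_y (cutoff_weight u du y *: jet theta u du y x) 0 k.
Proof.
move=> pu.
have i0 := integrable_cutoff_weight x pu (smooth_continuous st) tv.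
have i1 := integrable_cutoff_weight x pu
  (smooth_continuous (smooth_derive1 st)) (vanishes_beyond_derive1 tv).
case: (split_ordP k) => i ->.
  rewrite row_mxEl (cutoffE pu) mxE -RintegralZr//.
  by apply: eq_Rintegral => y _; rewrite mxE row_mxEl mxE mulrA.
rewrite row_mxEr !mxE -!RintegralZr// -RintegralD//.
- by apply: eq_Rintegral => y _; rewrite mxE row_mxEr !mxE mulrDr !mulrA.
- by rewrite /comp; under eq_fun do rewrite EFinM; exact: integrableZr.
- by rewrite /comp; under eq_fun do rewrite EFinM; exact: integrableZr.
Qed.

End Cutoff.

(** * Weighted estimates for differences *)

Section Estimates.
Context {R : realType} {n : nat}.
Notation mu := (@lebesgue_measure R).
Implicit Types u v du dv : R -> 'rV[R]_n.

Lemma measurable_energy_kernel m (K : R -> R -> 'rV[R]_m) :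
  (forall k, measurable_fun setT (fun z : R * R => K z.1 z.2 0 k)) ->
  measurable_fun setT (fun y => energy (K y)).
Proof.
move=> mK; apply: (measurable_fun_fubini_tonelli_F (m2 := mu)
  (fun z => (sqnorm (K z.1 z.2))%:E)).
  exact/measurable_EFinP/measurable_sqnorm.
by move=> z; rewrite lee_fin sqnorm_ge0.
Qed.

Variables chib theta : R -> R.
Hypothesis hchib : is_cutoff_function chib.
Hypothesis htheta : is_partition_generator theta.
Notation weight := (cutoff_weight chib theta).

Let kernel u du v dv (y x : R) : 'rV[R]_(n + n) :=
  weight u du y *: jet theta u du y x - weight v dv y *: jet theta v dv y x.

Let measurable_kernel u du v dv k : H1pair u du -> H1pair v dv ->
  measurable_fun setT (fun z : R * R => kernel u du v dv z.1 z.2 0 k).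
Proof.
move=> pu pv; have [mu_ mdu] := H1pair_measurable pu.
have [mv mdv] := H1pair_measurable pv.
have mw := measurableT_comp (measurable_cutoff_weight hchib htheta pu)
  (@measurable_fst _ _ R R).
have mw' := measurableT_comp (measurable_cutoff_weight hchib htheta pv)
  (@measurable_fst _ _ R R).
have E (z : R * R) : kernel u du v dv z.1 z.2 0 k =
    weight u du z.1 * jet theta u du z.1 z.2 0 k -
    weight v dv z.1 * jet theta v dv z.1 z.2 0 k.
  by rewrite /kernel mxE [in X in _ + X]mxE mxE [in X in _ + X]mxE.
under eq_fun do rewrite E.
exact: (measurable_funB (measurable_funM mw (measurable_jet htheta k mu_ mdu))
  (measurable_funM mw' (measurable_jet htheta k mv mdv))).
Qed.

Lemma measurable_energy_jetB u du v dv : H1pair u du -> H1pair v dv ->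
  measurable_fun setT (fun y => energy (fun x =>
    weight u du y *: jet theta u du y x - weight v dv y *: jet theta v dv y x)).
Proof.
move=> pu pv; apply: (measurable_energy_kernel (K := kernel u du v dv)) => k.
exact: measurable_kernel.
Qed.

(** Common source of two results: exponential weights lead to the Lipschitz estimate, and interval
    indicators with [v = 0] to the uniform bound. *)
Lemma cutoffB_estimate u du v dv (w W : R -> R) : H1pair u du -> H1pair v dv ->
  measurable_fun setT w -> measurable_fun setT W ->
  (forall x, 0 <= w x) -> (forall y, 0 <= W y) ->
  (forall x y, `|x - y| <= 2 -> w x <= W y) ->
  (\int[mu]_x (w x * (sqnorm (cutoff chib theta u x - cutoff chib theta v x)%R +
      sqnorm (dcutoff chib theta u du x - dcutoff chib theta v dv x)%R))%:E <=
   4%:E * \int[mu]_y ((W y)%:E * energy (kernel u du v dv y)))%E.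
Proof.
move=> pu pv mw mW w0 W0 wW.
pose X x := row_mx (cutoff chib theta u x) (dcutoff chib theta u du x) -
  row_mx (cutoff chib theta v x) (dcutoff chib theta v dv x).
rewrite (_ : (\int[mu]_x _)%E =
    (\int[mu]_x (w x * sqnorm (X x))%:E)%E); last first.
  apply: eq_integral => x _.
  by rewrite /X opp_row_mx add_row_mx sqnorm_row_mx.
have mX : measurable_rV X.
  have [mcu mdcu] := H1pair_measurable (H1pair_cutoff hchib htheta pu).
  have [mcv mdcv] := H1pair_measurable (H1pair_cutoff hchib htheta pv).
  have mrow (p q : R -> 'rV[R]_n) : measurable_rV p -> measurable_rV q ->
      measurable_rV (fun x => row_mx (p x) (q x)).
    move=> mp mq k; case: (split_ordP k) => i ->.
      by under eq_fun do rewrite row_mxEl; exact: mp.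
    by under eq_fun do rewrite row_mxEr; exact: mq.
  by apply: measurable_rVB; exact: mrow.
have iu x k := integrable_jet hchib htheta x k pu.
have iv x k := integrable_jet hchib htheta x k pv.
apply: kernel_estimate => //.
- by move=> k; exact: measurable_kernel.
- move=> y x yx; rewrite /kernel.
  rewrite (jet_eq0 htheta u du yx) (jet_eq0 htheta v dv yx).
  by apply/rowP => k; rewrite !mxE !mulr0 subr0.
- move=> x k; rewrite (_ : (fun _ => _) = ((fun y => ((weight u du y *:
      jet theta u du y x) 0 k)%:E) \- (fun y => ((weight v dv y *:
      jet theta v dv y x) 0 k)%:E))%E).
    exact: (integrableB measurableT (iu x k) (iv x k)).
  by apply/funext => y; rewrite /kernel mxE [in X in _ + X]mxE EFinB.
- move=> x k; rewrite /X mxE [in X in _ + X]mxE !row_mx_cutoffE//.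
  rewrite -(RintegralB measurableT (iu x k) (iv x k)).
  by apply: eq_Rintegral => y _; rewrite /kernel [RHS]mxE [in X in _ = _ + X]mxE.
Qed.

(** The way back from jet energies to a weighted norm of [u]. For fixed [x] the jet is bounded by
    [4 * M ^+ 2] times the density, on a [y]-interval of length 4, whence 16. *)
Lemma energy_jet_weight_le (M : R) u du (W b : R -> R) :
  (forall x, `|theta x| <= M /\ `|derive1 theta x| <= M) ->
  H1pair u du -> measurable_fun setT W -> measurable_fun setT b ->
  (forall y, 0 <= W y) -> (forall x, 0 <= b x) ->
  (forall x y, `|x - y| <= 2 -> W y <= b x) ->
  (\int[mu]_y ((W y)%:E * energy (jet theta u du y)) <=
   (16 * M ^+ 2)%:E * \int[mu]_x (b x * (sqnorm (u x) + sqnorm (du x)))%:E)%E.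
Proof.
move=> tM pu mW mb W0 b0 Wb; have [mu_ mdu] := H1pair_measurable pu.
have mj : measurable_fun setT (fun z : R * R => sqnorm (jet theta u du z.1 z.2)).
  by apply: measurable_sqnorm => k; exact: measurable_jet.
have mS : measurable_fun setT (fun x => sqnorm (u x) + sqnorm (du x)).
  by apply: measurable_funD; exact: measurable_sqnorm.
have S0 x : 0 <= sqnorm (u x) + sqnorm (du x) by rewrite addr_ge0 ?sqnorm_ge0.
apply: (@le_trans _ _ (\int[mu]_x ((b x)%:E *
    \int[mu]_y (sqnorm (jet theta u du y x))%:E))%E).
  apply: (tonelli_weight (f := fun y x => sqnorm (jet theta u du y x))) => //.
    by move=> y x; exact: sqnorm_ge0.
  move=> y x jyx; apply: Wb; rewrite leNgt.
  apply/negP => /(jet_eq0 htheta u du) j0.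
  by move: jyx; rewrite j0 sqnorm0 eqxx.
rewrite -ge0_integralZl//; last 3 first.
- by apply/measurable_EFinP; exact: measurable_funM.
- by move=> x _; rewrite lee_fin mulr_ge0.
- by rewrite lee_fin mulr_ge0 ?sqr_ge0.
have mjx x : measurable_fun setT (fun y => (sqnorm (jet theta u du y x))%:E).
  by apply/measurable_EFinP; exact: (measurableT_comp mj (pair2_measurable x)).
have j0 x : (0 <= \int[mu]_y (sqnorm (jet theta u du y x))%:E)%E.
  by apply: integral_ge0 => y _; rewrite lee_fin sqnorm_ge0.
apply: ge0_le_integral => //.
- by move=> x _; apply: mule_ge0; [rewrite lee_fin; exact: b0|exact: j0].
- apply: emeasurable_funM; first exact/measurable_EFinP.
  apply: (measurable_fun_fubini_tonelli_G (m1 := mu)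
    (fun z => (sqnorm (jet theta u du z.1 z.2))%:E)).
    exact/measurable_EFinP.
  by move=> z; rewrite lee_fin sqnorm_ge0.
- by apply: measurable_funeM; apply/measurable_EFinP; exact: measurable_funM.
move=> x _; rewrite -EFinM mulrCA EFinM.
apply: lee_wpmul2l; first by rewrite lee_fin.
pose I : set R := `[x - 2, x + 2]%classic.
pose C := 4 * M ^+ 2 * (sqnorm (u x) + sqnorm (du x)).
have C0 : 0 <= C by rewrite mulr_ge0// mulr_ge0// sqr_ge0.
have <- : (\int[mu]_y (C%:E * (EFin \o \1_I) y) =
    (16 * M ^+ 2 * (sqnorm (u x) + sqnorm (du x)))%:E)%E.
  rewrite ge0_integralZl//; last 2 first.
  - by apply/measurable_EFinP/measurable_indic; exact: measurable_itv.
  - by move=> y _; rewrite lee_fin.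
  rewrite integral_indic ?setIT; [|exact: measurableT|exact: measurable_itv].
  rewrite [X in (_ * X)%E]lebesgue_measure_itv/= lte_fin ifT; last lra.
  by rewrite -EFinB -EFinM /C; congr EFin; lra.
apply: ge0_le_integral => //.
- by move=> y _; rewrite lee_fin sqnorm_ge0.
- exact: mjx.
- apply: measurable_funeM; apply/measurable_EFinP/measurable_indic.
  exact: measurable_itv.
- move=> y _; rewrite /= -EFinM lee_fin indicE mem_setE in_itv/=.
  have [yI|yI] := boolP (_ <= y <= _).
    by rewrite mulr1; exact: sqnorm_jet_le.
  rewrite jet_eq0 ?sqnorm0 ?mulr0//.
  have := ler_norm (x - y); have := ler_norm (y - x).
  by rewrite [`|y - x|]distrC; lra.
Qed.

End Estimates.

(** * Translation, null sets and the Lipschitz estimate *)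

Section CutoffProperties.
Context {R : realType} {n : nat}.
Notation mu := (@lebesgue_measure R).
Implicit Types u v du dv : R -> 'rV[R]_n.
Variables chib theta : R -> R.
Hypothesis hchib : is_cutoff_function chib.
Hypothesis htheta : is_partition_generator theta.
Notation weight := (cutoff_weight chib theta).
Notation chi := (cutoff chib theta).

Lemma energy_jet_translate z u du y : H1pair u du ->
  energy (jet theta (translate z u) (translate z du) y) =
  energy (jet theta u du (y - z)).
Proof.
move=> /H1pair_measurable[mu_ mdu]; rewrite /energy.
under eq_integral do rewrite jet_translate.
rewrite -[RHS](@ge0_integral_shiftT _ (- z)) => [//||x].
  by apply/measurable_EFinP/measurable_sqnorm; exact: measurable_jet_x.
by rewrite lee_fin sqnorm_ge0.
Qed.

Lemma cutoff_translate y u : H1loc u ->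
  chi (translate y u) = translate y (chi u).
Proof.
move=> /(H1loc_pair htheta) pu; have put := H1pair_translate y pu.
rewrite (cutoffE hchib htheta put) (cutoffE hchib htheta pu).
apply/funext => x; rewrite /translate; congr (_ *: _).
have mh := measurable_cutoff_weight hchib htheta pu.
have mt := measurable_partition_generator htheta.
(* The weight follows the translation because jet energies do; shifting the variable of the
   convolution by [y] then gives the identity at every [x]. *)
have wE z : weight (translate y u) (translate y (weakD u)) (z + y) =
    weight u (weakD u) z.
  by rewrite /cutoff_weight /truncation (energy_jet_translate _ _ pu) addrK.
set h := weight (translate y u) _ in wE *.
have mf : measurable_fun setT (fun z : R => h z * theta (x - z)).
  apply: measurable_funM; first exact: measurable_cutoff_weight put.
  by apply: (measurableT_comp mt); exact: measurable_funB.
have := Rintegral_shift y mf.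
rewrite /convolution => <-; apply: eq_Rintegral => z _.
by rewrite wE opprD addrA addrAC.
Qed.

Lemma cutoff_ae u v : H1loc u -> H1loc v -> u = v %[ae mu] ->
  chi u = chi v %[ae mu].
Proof.
move=> hu hv uv; have pu := H1loc_pair htheta hu.
have [wv lv ldv] := H1loc_pair htheta hv.
(* [u] and [v] share a weak derivative. With the same derivative in both jets, the two weights
   coincide at every [y], since energies ignore null sets. *)
have pv : H1pair v (weakD u).
  have [wu _ ldu] := pu; have [l1v _ _] := wv.
  by split; [exact: is_weak_derivative_ae uv l1v wu|exact: lv|exact: ldu].
have [mu_ mdu] := H1pair_measurable pu; have [mv _] := H1pair_measurable pv.
have wE : weight u (weakD u) = weight v (weakD u).
  apply/funext => y; rewrite /cutoff_weight /truncation.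
  congr (chib (Num.sqrt (fine _))); apply: ae_eq_integral => //.
  - by apply/measurable_EFinP/measurable_sqnorm; exact: measurable_jet_x.
  - by apply/measurable_EFinP/measurable_sqnorm; exact: measurable_jet_x.
  by apply: ae_lebesgueS uv => x uvx _; rewrite /jet uvx.
rewrite (cutoffE hchib htheta pu) (cutoffE hchib htheta pv) wE.
by apply: ae_lebesgueS uv => x uvx _; rewrite uvx.
Qed.

Lemma cutoff_lipschitz (eta M : R) u v :
  (forall x, `|theta x| <= M /\ `|derive1 theta x| <= M) -> 0 < eta ->
  H1loc u -> H1loc v ->
  (H1exp_norm eta (fun x => chi u x - chi v x)%R <=
   (82 * M * expR (4 * eta))%:E * H1exp_norm eta (fun x => u x - v x)%R)%E.
Proof.
move=> tM eta0 /(H1loc_pair htheta) pu /(H1loc_pair htheta) pv.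
set du := weakD u in pu; set dv := weakD v in pv.
have M0 : 0 <= M by case: (tM 0) => t0 _; exact: le_trans t0.
pose w (x : R) := expR (- (2 * eta * `|x|)).
have mw : measurable_fun setT w.
  apply: measurableT_comp => //; apply: measurableT_comp => //.
  by apply: measurable_funM => //.
have w0 x : 0 <= w x by exact: expR_ge0.
have wle (x y : R) : `|x - y| <= 2 -> w x <= expR (4 * eta) * w y.
  move=> xy; rewrite /w -expRD ler_expR.
  have : `|y| <= `|x| + 2.
    by have := lerB_dist y x; rewrite distrC; lra.
  rewrite -(ler_pM2l eta0); lra.
(* Each of the two exchanges of variables moves the weight by at most 2 and costs a factor
   [expR (4 * eta)]. The square root at the end leaves one of them. *)
pose W y := expR (4 * eta) * w y.
pose b y := expR (4 * eta) * W y.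
have mW : measurable_fun setT W by exact: measurable_funM.
have mb : measurable_fun setT b by exact: measurable_funM.
have W0 x : 0 <= W x by rewrite mulr_ge0// expR_ge0.
have b0 x : 0 <= b x by rewrite mulr_ge0// expR_ge0.
have Wb (x y : R) : `|x - y| <= 2 -> W y <= b x.
  by rewrite distrC => /wle xy; rewrite ler_wpM2l// expR_ge0.
have puv := H1pairB pu pv.
have pcuv := H1pairB (H1pair_cutoff hchib htheta pu)
  (H1pair_cutoff hchib htheta pv).
rewrite /H1exp_norm (weighted_H1_normE htheta _ _ pcuv)//.
rewrite (weighted_H1_normE htheta _ _ puv)//.
set A := (\int[mu]_x _)%E; set B := (\int[mu]_x _)%E.
have [mu_ mdu] := H1pair_measurable puv.
have B0 : (0 <= B)%E.
  by apply: integral_ge0 => x _; rewrite lee_fin mulr_ge0// addr_ge0 ?sqnorm_ge0.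
have A0 : (0 <= A)%E.
  by apply: integral_ge0 => x _; rewrite lee_fin mulr_ge0// addr_ge0 ?sqnorm_ge0.
have mE := measurable_energy_jet htheta mu_ mdu.
have AB : (A <= ((82 * M * expR (4 * eta)) ^+ 2)%:E * B)%E.
  apply: (le_trans (cutoffB_estimate hchib htheta pu pv mw mW w0 W0 wle)).
  apply: (@le_trans _ _ (4%:E * (104%:E *
      \int[mu]_y ((W y)%:E * energy (jet theta (fun x => u x - v x)%R
        (fun x => du x - dv x)%R y))))%E).
    apply: lee_wpmul2l; first by rewrite lee_fin.
    rewrite -ge0_integralZl//; last 2 first.
    - by apply: emeasurable_funM => //; exact/measurable_EFinP.
    - by move=> y _; rewrite mule_ge0 ?energy_ge0 ?lee_fin.
    apply: ge0_le_integral => //.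
    - by move=> y _; rewrite mule_ge0 ?energy_ge0 ?lee_fin.
    - apply: emeasurable_funM; first exact/measurable_EFinP.
      exact: measurable_energy_jetB.
    - apply: measurable_funeM; apply: emeasurable_funM => //.
      exact/measurable_EFinP.
    move=> y _; rewrite muleCA; apply: lee_wpmul2l; first by rewrite lee_fin.
    rewrite (_ : jet theta (fun x => u x - v x) (fun x => du x - dv x) y =
      fun x => jet theta u du y x - jet theta v dv y x); last first.
      by apply/funext => x; rewrite jetB.
    apply: truncation_lipschitz => //.
    + by have [? ?] := H1pair_measurable pu; exact: measurable_jet_x.
    + by have [? ?] := H1pair_measurable pv; exact: measurable_jet_x.
    + exact: energy_jet_lty.
    + exact: energy_jet_lty.
  have := energy_jet_weight_le htheta tM puv mW mb W0 b0 Wb.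
  have -> : (\int[mu]_x (b x *
      (sqnorm (u x - v x)%R + sqnorm (du x - dv x)%R))%:E =
      (expR (4 * eta) ^+ 2)%:E * B)%E.
    rewrite /B -ge0_integralZl//.
    - by apply: eq_integral => x _; rewrite -EFinM /b /W !mulrA.
    - apply/measurable_EFinP; apply: measurable_funM => //.
      by apply: measurable_funD; exact: measurable_sqnorm.
    - by move=> x _; rewrite lee_fin mulr_ge0// addr_ge0 ?sqnorm_ge0.
  move=> H; rewrite muleA -EFinM.
  apply: (@le_trans _ _ ((4 * 104)%:E * ((16 * M ^+ 2)%:E *
    ((expR (4 * eta) ^+ 2)%:E * B)))%E).
    by apply: lee_wpmul2l => //; rewrite lee_fin.
  rewrite !muleA -!EFinM; apply: lee_wpmul2r => //; rewrite lee_fin.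
  (* The constants multiply to [4 * 104 * 16 = 6656], and [82 ^ 2 = 6724] is the next square of an
     integer. *)
  have := sqr_ge0 (M * expR (4 * eta)); lra.
have C0 : 0 <= 82 * M * expR (4 * eta) by rewrite !mulr_ge0 ?expR_ge0.
apply: (@le_trans _ _ ((((82 * M * expR (4 * eta)) ^+ 2)%:E * B) `^ 2^-1)%E).
  apply: gt0_ler_poweR => //; rewrite in_itv/= leey andbT//.
  by rewrite mule_ge0// lee_fin sqr_ge0.
rewrite poweRM//; last by rewrite lee_fin sqr_ge0.
by rewrite poweR_EFin powR12_sqrt ?sqr_ge0// sqrtr_sqr ger0_norm.
Qed.

End CutoffProperties.

(** * The bound in the uniformly local norm *)

Section UniformBounds.
Context {R : realType} {n : nat}.
Notation mu := (@lebesgue_measure R).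
Implicit Types u v du dv : R -> 'rV[R]_n.
Variables chib theta : R -> R.
Hypothesis hchib : is_cutoff_function chib.
Hypothesis htheta : is_partition_generator theta.
Notation weight := (cutoff_weight chib theta).
Notation chi := (cutoff chib theta).

(** The indicator of [[a - y, b - y]]. It turns the norm of a translate on [[0, 1]] into a weighted
    integral over the line, to which the estimates with general weights apply. *)
Definition window (a b y x : R) : R := \1_(`[a, b] : set R) (x + y).

Lemma windowE a b y x : window a b y x = (a <= x + y <= b)%R%:R.
Proof. by rewrite /window indicE mem_setE in_itv. Qed.

Lemma window_ge0 a b y x : 0 <= window a b y x.
Proof. by rewrite windowE. Qed.

Lemma measurable_window a b y : measurable_fun setT (window a b y).
Proof.
have mi : measurable_fun setT (\1_(`[a, b] : set R) : R -> R).
  by apply: measurable_indic; exact: measurable_itv.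
exact: (measurableT_comp mi (measurable_shift y)).
Qed.

Lemma integral_window (a b y : R) : a <= b ->
  (\int[mu]_x (window a b y x)%:E = (b - a)%:E)%E.
Proof.
move=> ab; have m1 :
    measurable_fun setT (fun x : R => (\1_(`[a, b] : set R) x : R)%:E).
  by apply/measurable_EFinP/measurable_indic; exact: measurable_itv.
rewrite /window (ge0_integral_shiftT y m1); last by move=> x; rewrite lee_fin.
rewrite integral_indic ?setIT; [|exact: measurableT|exact: measurable_itv].
rewrite [LHS]lebesgue_measure_itv/= lte_fin.
by case: ltP => // ba; have -> : a = b; [apply/le_anti/andP|rewrite subrr].
Qed.

Lemma H1_norm_on_translate y u du : H1pair u du ->
  H1_norm_on `[0, 1] (translate y u) =
  ((\int[mu]_x (window 0 1 y x * (sqnorm (u x) + sqnorm (du x)))%:E) `^ 2^-1)%E.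
Proof.
move=> pu; have [mu_ mdu] := H1pair_measurable pu.
have mS : measurable_fun setT (fun x => sqnorm (u x) + sqnorm (du x)).
  by apply: measurable_funD; exact: measurable_sqnorm.
rewrite /H1_norm_on (weighted_H1_normE htheta _ _ (H1pair_translate y pu))//.
congr (_ `^ _)%E; rewrite integral_mkcond.
pose f x := (\1_(`[0, 1] : set R) x *
  (sqnorm (u (x - y)) + sqnorm (du (x - y))))%:E.
have mf : measurable_fun setT f.
  apply/measurable_EFinP; apply: measurable_funM.
    by apply: measurable_indic; exact: measurable_itv.
  exact: (@measurable_translate _ (fun x => sqnorm (u x) + sqnorm (du x)) y mS).
have f0 x : (0 <= f x)%E by rewrite lee_fin mulr_ge0// addr_ge0 ?sqnorm_ge0.
transitivity (\int[mu]_x f x)%E.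
  apply: eq_integral => x _; rewrite patchE /f indicE.
  by case: ifPn => _; [rewrite !mul1r|rewrite mul0r].
rewrite -(ge0_integral_shiftT y mf f0).
by apply: eq_integral => x _; rewrite /f addrK.
Qed.

Lemma cutoff0 : chi (fun=> 0 : 'rV[R]_n) = fun=> 0.
Proof.
rewrite (cutoffE hchib htheta (H1pair0 (R := R) (n := n))).
by apply/funext => x; rewrite scaler0.
Qed.

(** Comparison with the zero function: 4 comes from the kernel estimate, 144 bounds the energy of
    each truncated jet, and 5 is the length of the unit window widened by 2 on both sides. *)
Lemma cutoff_uniform_bound u : H1loc u ->
  (H1u_norm (chi u) <= (4 * (144 * 5))%:E `^ 2^-1)%E.
Proof.
move=> /(H1loc_pair htheta) pu; set du := weakD u in pu.
have p0 : H1pair (fun=> 0 : 'rV[R]_n) (fun=> 0) := H1pair0.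
apply: ge_ereal_sup => _ [y _ <-].
rewrite (H1_norm_on_translate y (H1pair_cutoff hchib htheta pu)).
have wW (x z : R) : `|x - z| <= 2 -> window 0 1 y x <= window (-2) 3 y z.
  rewrite ler_norml !windowE => /andP[z1 z2].
  have [/andP[x1 x2]|_] := boolP (0 <= _ <= 1); last by rewrite ler0n.
  by have -> : -2 <= z + y <= 3 by lra.
have dc0 x : dcutoff chib theta (fun=> 0 : 'rV[R]_n) (fun=> 0) x = 0.
  by rewrite /dcutoff !scaler0 addr0.
have k0 z x : weight (fun=> 0 : 'rV[R]_n) (fun=> 0) z *:
    jet theta (fun=> 0 : 'rV[R]_n) (fun=> 0) z x = 0.
  by rewrite /jet !scaler0 addr0 row_mx0; apply/rowP => k; rewrite !mxE mulr0.
have := cutoffB_estimate hchib htheta pu p0 (measurable_window 0 1 y)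
  (measurable_window (-2) 3 y) (window_ge0 _ _ y) (window_ge0 _ _ y) wW.
have -> : (\int[mu]_x (window 0 1 y x *
     (sqnorm (chi u x - chi (fun=> 0%R : 'rV[R]_n) x)%R +
      sqnorm (dcutoff chib theta u du x -
       dcutoff chib theta (fun=> 0%R : 'rV[R]_n) (fun=> 0%R) x)%R))%:E =
   \int[mu]_x (window 0 1 y x * (sqnorm (chi u x) +
     sqnorm (dcutoff chib theta u du x)))%:E)%E.
  by apply: eq_integral => x _; rewrite cutoff0 dc0 !subr0.
move=> est.
apply: gt0_ler_poweR => //.
- rewrite in_itv/= leey andbT; apply: integral_ge0 => x _.
  by rewrite lee_fin mulr_ge0 ?window_ge0// addr_ge0 ?sqnorm_ge0.
- by rewrite in_itv/= leey andbT lee_fin !mulr_ge0 ?ler0n.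
apply: (le_trans est).
apply: (@le_trans _ _ (4%:E * \int[mu]_z (144%:E * (window (-2) 3 y z)%:E))%E).
  apply: lee_wpmul2l; first by rewrite lee_fin.
  apply: ge0_le_integral => //.
  - by move=> z _; rewrite mule_ge0 ?energy_ge0 ?lee_fin ?window_ge0.
  - apply: emeasurable_funM; last exact: measurable_energy_jetB.
    by apply/measurable_EFinP; exact: measurable_window.
  - by apply: measurable_funeM; apply/measurable_EFinP; exact: measurable_window.
  move=> z _; rewrite muleC.
  apply: lee_wpmul2r; first by rewrite lee_fin window_ge0.
  have [mu_ mdu] := H1pair_measurable pu.
  have mj := measurable_jet_x htheta z mu_ mdu.
  apply: le_trans (truncation_energy_le hchib (energy_jet_lty htheta z pu)).
  rewrite /energy -ge0_integralZl//; last 3 first.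
  - by apply/measurable_EFinP; apply: measurable_sqnorm; exact: mj.
  - by move=> x _; rewrite lee_fin sqnorm_ge0.
  - by rewrite lee_fin sqr_ge0.
  rewrite le_eqVlt; apply/orP; left; apply/eqP; apply: eq_integral => x _.
  by rewrite k0 subr0 sqnormZ EFinM.
rewrite ge0_integralZl//; last 2 first.
- apply/measurable_EFinP; exact: measurable_window.
- by move=> z _; rewrite lee_fin window_ge0.
rewrite integral_window; last lra.
by rewrite -!EFinM opprK (_ : 3 + 2 = 5)//; ring.
Qed.

End UniformBounds.

(** * Small functions are fixed *)

Section SmallData.
Context {R : realType} {n : nat}.
Notation mu := (@lebesgue_measure R).
Variables chib theta : R -> R.
Hypothesis hchib : is_cutoff_function chib.
Hypothesis htheta : is_partition_generator theta.
Implicit Types u du : R -> 'rV[R]_n.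

Lemma integral_window_le (C : R) u du y : 0 <= C -> H1pair u du ->
  (H1u_norm u < C%:E)%E ->
  (\int[mu]_x (window 0 1 y x * (sqnorm (u x) + sqnorm (du x)))%:E <=
   (C ^+ 2)%:E)%E.
Proof.
move=> C0 pu uC; rewrite leNgt; apply/negP => CI.
have : (C%:E <= H1_norm_on `[0%R, 1%R] (translate y u))%E.
  have -> : (C%:E = (C ^+ 2)%:E `^ 2^-1)%E.
    by rewrite poweR_EFin powR12_sqrt ?sqr_ge0// sqrtr_sqr ger0_norm.
  rewrite (H1_norm_on_translate htheta y pu).
  apply: gt0_ler_poweR; last exact: ltW.
  - by rewrite invr_ge0.
  - by rewrite in_itv/= leey andbT lee_fin sqr_ge0.
  - rewrite in_itv/= leey andbT; apply: integral_ge0 => x _.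
    by rewrite lee_fin mulr_ge0 ?window_ge0// addr_ge0 ?sqnorm_ge0.
rewrite leNgt => /negP; apply; apply: le_lt_trans uC.
by apply: ereal_sup_ubound; exists y.
Qed.

(** Four unit windows cover [[y - 2, y + 2]], each contributing at most the square of [(8 * M)^-1];
    times [4 * M ^+ 2] this makes 1/4. The jet then has norm at most 1/2, where [chib] is 1. *)
Lemma energy_jet_small (M : R) u du y : 0 < M ->
  (forall x, `|theta x| <= M /\ `|derive1 theta x| <= M) -> H1pair u du ->
  (H1u_norm u < ((8 * M)^-1)%:E)%E ->
  (energy (jet theta u du y) <= (4^-1)%:E)%E.
Proof.
move=> M0 tM pu uC; have [mu_ mdu] := H1pair_measurable pu.
pose S x := sqnorm (u x) + sqnorm (du x).
have mS : measurable_fun setT S.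
  by apply: measurable_funD; exact: measurable_sqnorm.
have S0 x : 0 <= S x by rewrite addr_ge0 ?sqnorm_ge0.
(* Window [j] selects [x - y] between [j - 2] and [j - 1]. *)
pose f (j : 'I_4) x := (window 0 1 (2 - y - j%:R) x * S x)%:E.
have mf j : measurable_fun setT (f j).
  apply/measurable_EFinP; apply: measurable_funM => //; exact: measurable_window.
have f0 j x : (0 <= f j x)%E by rewrite lee_fin mulr_ge0 ?window_ge0.
have C0 : 0 <= 4 * M ^+ 2 by rewrite mulr_ge0// sqr_ge0.
apply: (@le_trans _ _ ((4 * M ^+ 2)%:E * \sum_(j < 4) \int[mu]_x f j x)%E).
  rewrite -ge0_integral_sum//.
  have msum : measurable_fun setT (fun x => \sum_(j < 4) f j x)%E.
    by apply: emeasurable_sum.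
  rewrite -ge0_integralZl//; last by move=> x _; exact: sume_ge0.
  apply: ge0_le_integral => //.
  - by move=> x _; rewrite lee_fin sqnorm_ge0.
  - by apply/measurable_EFinP/measurable_sqnorm; exact: measurable_jet_x.
  - exact: measurable_funeM.
  move=> x _; have [xy|xy] := ltP 2 `|x - y|.
    rewrite jet_eq0// sqnorm0 mule_ge0 ?lee_fin//.
    by apply: sume_ge0 => j _; exact: f0.
  have [j wj] : exists j : 'I_4, window 0 1 (2 - y - j%:R) x = 1.
    move: xy; rewrite ler_norml => /andP[x1 x2].
    have E (j : 'I_4) : 0 <= x + (2 - y - j%:R) <= 1 ->
        window 0 1 (2 - y - j%:R) x = 1 by rewrite windowE => ->.
    case: (leP (x - y) (-1)) => [?|?].
      by exists (@Ordinal 4 0 isT); apply: E => /=; lra.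
    case: (leP (x - y) 0) => [?|?].
      by exists (@Ordinal 4 1 isT); apply: E => /=; lra.
    case: (leP (x - y) 1) => [?|?].
      by exists (@Ordinal 4 2 isT); apply: E => /=; lra.
    by exists (@Ordinal 4 3 isT); apply: E => /=; lra.
  apply: (@le_trans _ _ ((4 * M ^+ 2)%:E * f j x)%E).
    by rewrite -EFinM lee_fin wj mul1r; exact: sqnorm_jet_le.
  apply: lee_wpmul2l; first by rewrite lee_fin.
  by rewrite (bigD1 j)//= leeDl//; apply: sume_ge0.
apply: (@le_trans _ _ ((4 * M ^+ 2)%:E * \sum_(j < 4) (((8 * M)^-1) ^+ 2)%:E)%E).
  apply: lee_wpmul2l; first by rewrite lee_fin.
  apply: lee_sum => j _; apply: integral_window_le => //.
  by rewrite invr_ge0 mulr_ge0// ltW.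
rewrite sumEFin big_const_ord iter_addr_0 -EFinM lee_fin.
rewrite le_eqVlt; apply/orP; left; apply/eqP.
by rewrite -[X in _ * X]mulr_natl; field; rewrite gt_eqF.
Qed.

Lemma cutoff_small (M : R) u : 0 < M ->
  (forall x, `|theta x| <= M /\ `|derive1 theta x| <= M) -> H1loc u ->
  (H1u_norm u < ((8 * M)^-1)%:E)%E -> cutoff chib theta u = u.
Proof.
move=> M0 tM /(H1loc_pair htheta) pu uC.
rewrite (cutoffE hchib htheta pu); apply/funext => x.
suff -> : convolution (cutoff_weight chib theta u (weakD u)) theta x = 1.
  by rewrite scale1r.
transitivity (\int[mu]_y theta (x - y)); last first.
  by rewrite /Rintegral integral_partition_generator.
apply: eq_Rintegral => y _.
have E4 := energy_jet_small y M0 tM pu uC.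
suff -> : cutoff_weight chib theta u (weakD u) y = 1 by rewrite mul1r.
case: hchib => _ _ c1 _; apply: c1.
rewrite ger0_norm ?sqrtr_ge0// -[ltRHS]sqrtr1 ltr_sqrt//.
have Ef : energy (jet theta u (weakD u) y) \is a fin_num.
  by rewrite ge0_fin_numE ?energy_ge0// (le_lt_trans E4)// ltry.
by rewrite -lte_fin fineK// (le_lt_trans E4)// lte_fin; lra.
Qed.

End SmallData.

Theorem lemma1p2 (R : realType) (n : nat) (hn : (1 <= n)%N)
    (chib theta : R -> R)
    (hchib : is_cutoff_function chib) (htheta : is_partition_generator theta)
    (eta : R) (heta : 0 < eta) :
  let chi : (R -> 'rV[R]_n) -> (R -> 'rV[R]_n) := cutoff chib theta in
  exists C0 C1 CL : R, [/\ 0 < C0, 0 < C1 & 0 < CL] /\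
  [/\ (* (i) the formula makes sense, lands in the space, and respects
             almost-everywhere equality *)
      (forall u, H1exp eta u ->
         [/\ forall y, H1 (localize theta y u),
             forall x i, (@lebesgue_measure R).-integrable setT
               (fun y => (cutoff_integrand chib theta u x i y)%:E) &
             H1exp eta (chi u)]) /\
      (forall u v, H1exp eta u -> H1exp eta v ->
         u = v %[ae @lebesgue_measure R] ->
         chi u = chi v %[ae @lebesgue_measure R]),
      (* (ii) *)
      forall (y : R) u, H1exp eta u ->
        chi (translate y u) = translate y (chi u) %[ae @lebesgue_measure R],
      (* (iii) *)
      forall u, H1u u -> (H1u_norm u < C0%:E)%E ->
        chi u = u %[ae @lebesgue_measure R],
      (* (iv) *)
      forall u, H1exp eta u -> H1u (chi u) /\ (H1u_norm (chi u) < C1%:E)%E &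
      (* (v) *)
      forall u v, H1exp eta u -> H1exp eta v ->
        (H1exp_norm eta (fun x => chi u x - chi v x)%R
           <= CL%:E * H1exp_norm eta (fun x => u x - v x)%R)%E].
Proof.
move=> chi.
have [M M0 tM] := partition_generator_bound htheta.
pose B : R := Num.sqrt (4 * (144 * 5)).
(* [B] is the root of the bound in [cutoff_uniform_bound]; adding 1 makes the inequality of (iv)
   strict. *)
exists (8 * M)^-1, (B + 1), (82 * M * expR (4 * eta)).
have CL0 : 0 < 82 * M * expR (4 * eta) by rewrite !mulr_gt0 ?ltr0n ?expR_gt0.
split.
  split=> //; first by rewrite invr_gt0 mulr_gt0 ?ltr0n.
  by rewrite ltr_wpDl ?sqrtr_ge0.
have lip u v : H1loc u -> H1loc v ->
    (H1exp_norm eta (fun x => chi u x - chi v x)%R <=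
     (82 * M * expR (4 * eta))%:E * H1exp_norm eta (fun x => u x - v x)%R)%E.
  exact: cutoff_lipschitz.
have h1loc u : H1loc u -> H1loc (chi u).
  by move=> /(H1loc_pair htheta)/(H1pair_cutoff hchib htheta)/H1pair_loc.
split.
- split=> [u [hu unorm]|u v [hu _] [hv _]]; last exact: cutoff_ae.
  split=> [y|x i|]; first exact: H1_localize.
    exact: integrable_cutoff_integrand.
  split; first exact: h1loc.
  (* Since [chi] fixes 0, the Lipschitz estimate against 0 bounds the norm of [chi u] by a multiple
     of that of [u]. *)
  have := lip u _ hu (H1pair_loc H1pair0).
  under [X in H1exp_norm _ X]eq_fun do rewrite /chi (cutoff0 hchib htheta) subr0.
  under [X in (_ <= _ * H1exp_norm _ X)%E]eq_fun do rewrite subr0.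
  move=> /le_lt_trans -> //; apply: lte_mul_pinfty => //.
  by rewrite lee_fin ltW.
(* Here and in (iii) the equality of functions holds at every point. *)
- by move=> y u [hu _]; rewrite /chi cutoff_translate//; exact: ae_eq_refl.
- move=> u [hu _] uC; rewrite /chi (cutoff_small hchib htheta M0 tM hu uC).
  exact: ae_eq_refl.
- move=> u [hu _].
  have uB : (H1u_norm (chi u) < (B + 1)%:E)%E.
    apply: (le_lt_trans (cutoff_uniform_bound hchib htheta hu)).
    by rewrite poweR_EFin powR12_sqrt ?lte_fin ?ltrDl// !mulr_ge0 ?ler0n.
  split=> //; split; first exact: h1loc.
  by rewrite (lt_trans uB)// ltry.
- by move=> u v [hu _] [hv _]; exact: lip.
Qed.
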